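(* Let $G$ be a mixed signed, directed graph and $k$ a field. The edge ring $k[G]$ satisfies Serre's condition $R_1$ if and only if every facet subgraph $H$ of $G$ satisfies $\mathrm{comp}(H)\le\mathrm{comp}(G)+1$.
   Context: A mixed signed, directed graph $G$ on vertex set $\{1,\dots,n\}$ has a set of signed edges $+ij$ or $-ij$ (loops $\pm ii$ allowed) and directed edges $(i,j)$ with $i\ne j$; between a pair of vertices any subset of $+ij,-ij,(i,j),(j,i)$ may occur. Define $\rho(\pm ij)=\pm(e_i+e_j)$ (so $\rho(\pm ii)=\pm2e_i$) and $\rho((i,j))=e_j-e_i$ in $\mathbb{R}^n$. The edge ring is $k[G]=k[x^a: a\in\rho(E(G))]\subseteq k[x_1^{\pm1},\dots,x_n^{\pm1}]$, $x^a=\prod x_i^{a_i}$. A Noetherian ring $R$ satisfies $R_1$ if $R_\mathfrak p$ is regular for all primes $\mathfrak p$ with $\dim R_\mathfrak p\le 1$. The augmented signed graph $\widetilde G$ is obtained by replacing each directed edge $(i,j)$ by a new (artificial) vertex $t_{(i,j)}$ and the two signed edges $-i\,t_{(i,j)}$ and $+t_{(i,j)}\,j$. A subgraph $H$ of $G$ has vertex set $\{1,\dots,n\}$ and a subset of the edges of $G$; $G\setminus H$ is the set of edges of $G$ not in $H$; $\widetilde H$ is the augmented graph of $H$ (with artificial vertices only for directed edges of $H$). For a signed graph, a component is a maximal connected subgraph (isolated vertices are components), and it is bipartite if its vertex set can be partitioned into $L,R$ (one possibly empty) with every edge having one endpoint in each (a component with a loop is not bipartite). Components and bipartite components of $G$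 (resp. $H$) are those of $\widetilde G$ (resp. $\widetilde H$); $\mathrm{comp}(\cdot)$ and $\mathrm{bicomp}(\cdot)$ count components and bipartite components. For a set $S$ of vertices of an augmented graph, $\pi(S)=S\cap\{1,\dots,n\}$. A subgraph $H$ of $G$ is a facet subgraph if (1) $\mathrm{bicomp}(H)=\mathrm{bicomp}(G)+1$, and (2) for any bipartite component $H'$ of $H$ which is not a component of $G$, there is a bipartition $V(\widetilde{H'})=\widetilde L\cup\widetilde R$ such that, with $L=\pi(\widetilde L)$ and $R=\pi(\widetilde R)$, every edge $e\in G\setminus H$ is of one of the forms: a positive edge with at least one endpoint in $L$ and none in $R$; a negative edge with at least one endpoint in $R$ and none in $L$; a directed edge $(i,j)$ with $j\in L$ and $i\notin L$; or a directed edge $(i,j)$ with $i\in R$ and $j\notin R$. *)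

(* Defs.v *)
From HB Require Import structures.
From mathcomp Require Import all_boot all_order all_algebra.
From mathcomp Require Import mpoly.
Set Implicit Arguments.
Unset Strict Implicit.
Unset Printing Implicit Defensive.
Import Order.TTheory GRing.Theory Num.Theory.

(* Signed edges are unordered: we store them with i <= j (see wf_graph).    *)
Definition edge (n : nat) : finType :=
  ((('I_n * 'I_n) + ('I_n * 'I_n)) + ('I_n * 'I_n))%type.

Definition pos_edge {n} (i j : 'I_n) : edge n := inl (inl (i, j)).
Definition neg_edge {n} (i j : 'I_n) : edge n := inl (inr (i, j)).
Definition dir_edge {n} (i j : 'I_n) : edge n := inr (i, j).

Definition wf_edge {n} (e : edge n) : bool :=
  match e with
  | inl (inl (i, j)) => (i <= j)%N
  | inl (inr (i, j)) => (i <= j)%N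
  | inr (i, j) => i != j
  end.
Definition wf_graph {n} (G : {set edge n}) : bool := [forall e in G, wf_edge e].

Definition is_dir {n} (e : edge n) : bool :=
  if e is inr _ then true else false.

(* Augmented graph: vertices are original vertices inl i or artificial      *)
(* vertices inr e = t_e for directed edges e; augmented edges are signed    *)
(* edges (sign, x, y) with sign true = +, false = -.                        *)
Definition avert (n : nat) : finType := ('I_n + edge n)%type.
Definition aedge (n : nat) : finType := (bool * avert n * avert n)%type.

Definition aug_img {n} (e : edge n) : seq (aedge n) :=
  match e with
  | inl (inl (i, j)) => [:: (true, inl i, inl j)]
  | inl (inr (i, j)) => [:: (false, inl i, inl j)]
  | inr (i, j) => [:: (false, inl i, inr e); (true, inr e, inl j)]
  end.

Definition aug_verts {n} (H : {set edge n}) : {set avert n} :=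
  [set v : avert n | match v with inl _ => true | inr e => (e \in H) && is_dir e end].

Definition aug_edges {n} (H : {set edge n}) : {set aedge n} :=
  [set a : aedge n | [exists e in H, a \in aug_img e]].

Definition adj {n} (E : {set aedge n}) : rel (avert n) :=
  fun x y => [exists s : bool, ((s, x, y) \in E) || ((s, y, x) \in E)].

Definition comp_of {n} (H : {set edge n}) (x : avert n) : {set avert n} :=
  [set y in aug_verts H | connect (adj (aug_edges H)) x y].

Definition comps {n} (H : {set edge n}) : {set {set avert n}} :=
  [set comp_of H x | x in aug_verts H].

Definition ncomp {n} (H : {set edge n}) : nat := #|comps H|.

Definition is_bipartition {n} (E : {set aedge n}) (C L : {set avert n}) : bool :=
  (L \subset C) &&
  [forall a in E, let: (s, x, y) := a in
     ((x \in C) || (y \in C)) ==> ((x \in L) != (y \in L))].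

Definition bipartite {n} (E : {set aedge n}) (C : {set avert n}) : bool :=
  [exists L : {set avert n}, is_bipartition E C L].

Definition nbicomp {n} (H : {set edge n}) : nat :=
  #|[set C in comps H | bipartite (aug_edges H) C]|.

Definition edges_in {n} (E : {set aedge n}) (C : {set avert n}) : {set aedge n} :=
  [set a in E | (a.1.2 \in C) && (a.2 \in C)].

Definition is_comp_of {n} (G H : {set edge n}) (C : {set avert n}) : bool :=
  (C \in comps G) && (edges_in (aug_edges G) C == edges_in (aug_edges H) C).

Definition proj_orig {n} (S : {set avert n}) : {set 'I_n} :=
  [set i : 'I_n | inl i \in S].

Definition good_edge {n} (L R : {set 'I_n}) (e : edge n) : bool :=
  match e with
  | inl (inl (i, j)) => ((i \in L) || (j \in L)) && (i \notin R) && (j \notin R)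
  | inl (inr (i, j)) => ((i \in R) || (j \in R)) && (i \notin L) && (j \notin L)
  | inr (i, j) => ((j \in L) && (i \notin L)) || ((i \in R) && (j \notin R))
  end.

Definition facet_subgraph {n} (G H : {set edge n}) : bool :=
  (H \subset G) &&
  (nbicomp H == (nbicomp G).+1) &&
  [forall C in comps H,
     (bipartite (aug_edges H) C && ~~ is_comp_of G H C) ==>
     [exists Lt : {set avert n},
        is_bipartition (aug_edges H) C Lt &&
        [forall e in G :\: H,
           good_edge (proj_orig Lt) (proj_orig (C :\: Lt)) e]]].

Local Open Scope ring_scope.

Definition LFrac (k : fieldType) (n : nat) := {fraction {mpoly k[n]}}.

Definition lmono {k : fieldType} {n : nat} (a : 'I_n -> int) : LFrac k n :=
  \prod_(i < n) (FracField.tofrac ('X_i : {mpoly k[n]})) ^ (a i).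

Definition rho {n} (e : edge n) : 'I_n -> int :=
  match e with
  | inl (inl (i, j)) => fun l => ((l == i)%:Z + (l == j)%:Z)%R
  | inl (inr (i, j)) => fun l => (- ((l == i)%:Z + (l == j)%:Z))%R
  | inr (i, j) => fun l => ((l == j)%:Z - (l == i)%:Z)%R
  end.

Inductive edge_ring {k : fieldType} {n : nat} (G : {set edge n}) : LFrac k n -> Prop :=
  | er_const (c : k) : edge_ring G (FracField.tofrac (c%:MP))
  | er_gen (e : edge n) : e \in G -> edge_ring G (lmono (rho e))
  | er_add x y : edge_ring G x -> edge_ring G y -> edge_ring G (x + y)
  | er_mul x y : edge_ring G x -> edge_ring G y -> edge_ring G (x * y).

Section CommAlg.
Variable F : fieldType.
Implicit Types (S I P : F -> Prop).

Definition is_ideal S I : Prop :=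
  (forall x, I x -> S x) /\ I 0 /\
  (forall x y, I x -> I y -> I (x + y)) /\
  (forall r x, S r -> I x -> I (r * x)).

Definition is_prime S P : Prop :=
  is_ideal S P /\ ~ P 1 /\
  (forall a b, S a -> S b -> P (a * b) -> P a \/ P b).

Definition is_maximal S I : Prop :=
  is_ideal S I /\ ~ I 1 /\
  (forall J, is_ideal S J -> (forall x, I x -> J x) ->
             (forall x, J x <-> I x) \/ J 1).

Definition localization S P : F -> Prop :=
  fun z => exists a s, S a /\ S s /\ ~ P s /\ z = a / s.

Definition prime_chain S (d : nat) : Prop :=
  exists q : nat -> F -> Prop,
    (forall i, (i <= d)%N -> is_prime S (q i)) /\
    (forall i, (i < d)%N ->
       (forall x, q i x -> q i.+1 x) /\ exists x, q i.+1 x /\ ~ q i x).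

Definition krull_dim_eq S (d : nat) : Prop :=
  prime_chain S d /\ ~ prime_chain S d.+1.
Definition krull_dim_le S (d : nat) : Prop := ~ prime_chain S d.+1.

Definition gen_by S (m : nat) (a : 'I_m -> F) : F -> Prop :=
  fun z => exists r : 'I_m -> F, (forall i, S (r i)) /\ z = \sum_(i < m) r i * a i.

Definition regular_local S : Prop :=
  exists M, is_maximal S M /\
    (forall M', is_maximal S M' -> forall x, M' x <-> M x) /\
    exists d, krull_dim_eq S d /\
      exists a : 'I_d -> F, forall x, M x <-> gen_by S a x.

Definition serre_R1 S : Prop :=
  forall P, is_prime S P -> krull_dim_le (localization S P) 1 ->
    regular_local (localization S P).

End CommAlg.

(* Main.v *)
Require Import Defs.
From HB Require Import structures.
From mathcomp Require Import all_boot all_order all_algebra.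
From mathcomp Require Import mpoly.
From mathcomp Require Import boolp ring lra zify.
Set Implicit Arguments.
Unset Strict Implicit.
Unset Printing Implicit Defensive.
Import Order.TTheory GRing.Theory Num.Theory.
Local Open Scope ring_scope.

(**
Write Q for the semigroup generated by the vectors rho(e), so that k[G] = k[Q],
and ZZ H for the lattice generated by rho(H).

A facet subgraph H is the set of edges on a facet of the cone of Q: a bipartite
component C of H that is not a component of G gives a functional
sigma = 1_L - 1_R that vanishes on H and takes the values 1 and 2 on the other
edges.  Functionals with values in F_2 (resp. F_3) that vanish on rho(H) are
counted by 2^comp(H) (resp. 3^bicomp(H)), and together they detect ZZ H.  Hence
comp(H) <= comp(G) + 1 holds iff rho(e) - rho(e') is in ZZ H whenever
sigma(e) = sigma(e') = 1.

If this fails at a facet, its prime P has height one (a norm from k[ZZ G] down to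
k[ZZ H + ZZ rho(e1)] shows that no smaller nonzero prime exists), but
x^(rho(e1) - rho(e2)) is a quotient of two elements of P outside P^2 which is not
in k[Q]_P, so P k[Q]_P is not principal.  Conversely let P be a prime of height one.
If P contains no monomial, then k[Q]_P is a localization of a polynomial
ring at a height one prime, which is locally principal.  Otherwise the edges
whose monomials avoid P span a proper face; a Gordan-type alternative puts it in
a facet, whose prime is then P, and P k[Q]_P is generated by the monomial of any
edge outside the facet with least sigma.
*)


(** * Localization at a prime *)

(** The integral functionals [sgn C L] detect ZZ H only up to a quotient of exponent 2: twice any
    vector that they kill lies in ZZ H. Parity is the one obstruction left, and it is visible over
    F_2, where every component, bipartite or not, carries a functional. An edge with sigma(e) = 2
    has both ends in C, so the F_2 functionals that kill H vanish on it; this is why only edges of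
    value 1 matter. Comparing ranks is replaced throughout by comparing cardinalities of sets of
    functionals. The same exponent 2 shapes the height computation. The index of ZZ H + ZZ rho(e1)
    in ZZ G may exceed 1, but the quotient has exponent dividing 2, so the norm is a succession of
    products (a + b)(a - b). Only disjointness of supports and the absence of zero divisors enter,
    hence any characteristic is allowed. The height of a facet prime is computed only when the bound
    on components fails, which is what supplies an edge e1 of value 1; in the converse direction the
    dimension bound is given. *)

Section Localization.
Variable F : fieldType.
Implicit Types (S P Q : F -> Prop) (x y z : F).

Definition is_subring S : Prop :=
  S 1 /\ (forall x y, S x -> S y -> S (x - y)) /\
  (forall x y, S x -> S y -> S (x * y)).

Lemma subring1 S : is_subring S -> S 1. Proof. by case. Qed.
Lemma subringB S : is_subring S -> forall x y, S x -> S y -> S (x - y).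
Proof. by case=> _ []. Qed.
Lemma subringM S : is_subring S -> forall x y, S x -> S y -> S (x * y).
Proof. by case=> _ []. Qed.
Lemma subring0 S : is_subring S -> S 0.
Proof. by move=> hS; rewrite -(subrr 1); apply: subringB; try exact: subring1. Qed.
Lemma subringN S : is_subring S -> forall x, S x -> S (- x).
Proof. by move=> hS x Sx; rewrite -sub0r; apply: subringB => //; exact: subring0. Qed.
Lemma subringD S : is_subring S -> forall x y, S x -> S y -> S (x + y).
Proof.
by move=> hS x y Sx Sy; rewrite -[y]opprK; apply: subringB => //; exact: subringN.
Qed.

Lemma primeW S P : is_prime S P -> forall x, P x -> S x.
Proof. by case=> -[]. Qed.
Lemma prime0 S P : is_prime S P -> P 0.
Proof. by case=> -[_ []]. Qed.
Lemma primeD S P : is_prime S P -> forall x y, P x -> P y -> P (x + y).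
Proof. by case=> -[_ [_ []]]. Qed.
Lemma primeMl S P : is_prime S P -> forall r x, S r -> P x -> P (r * x).
Proof. by case=> -[_ [_ []]]. Qed.
Lemma primeMr S P : is_prime S P -> forall x r, P x -> S r -> P (x * r).
Proof. by move=> hP x r Px Sr; rewrite mulrC; apply: (primeMl hP). Qed.
Lemma primeN1 S P : is_prime S P -> ~ P 1.
Proof. by case=> _ []. Qed.
Lemma prime_mul S P : is_prime S P ->
  forall x y, S x -> S y -> P (x * y) -> P x \/ P y.
Proof. by case=> _ []. Qed.
Lemma prime_notinM S P : is_prime S P ->
  forall x y, S x -> S y -> ~ P x -> ~ P y -> ~ P (x * y).
Proof. by move=> hP x y Sx Sy nx ny /(prime_mul hP Sx Sy) []. Qed.
Lemma prime_neq0 S P x : is_prime S P -> ~ P x -> x != 0.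
Proof. by move=> hP; apply: contra_notN => /eqP->; exact: (prime0 hP). Qed.

Lemma prime_zero S : is_subring S -> is_prime S (fun x => x = 0).
Proof.
move=> hS; split; first split.
- by move=> x ->; exact: subring0.
- split=> //; split=> [x y -> ->|r x _ ->]; by rewrite ?addr0 ?mulr0.
- split; first by move/eqP; rewrite oner_eq0.
- by move=> a b _ _ /eqP; rewrite mulf_eq0 => /orP [] /eqP; [left|right].
Qed.

Definition loc_ideal S P Q : F -> Prop :=
  fun z => exists a s, Q a /\ S s /\ ~ P s /\ z = a / s.

Section AtPrime.
Variables (S P : F -> Prop).
Hypotheses (hS : is_subring S) (hP : is_prime S P).
Let A := localization S P.
Let M := loc_ideal S P P.

Let Pn0 s : ~ P s -> s != 0. Proof. exact: (prime_neq0 hP). Qed.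

Lemma loc_incl x : S x -> A x.
Proof.
move=> Sx; exists x, 1; split=> //; split; first exact: subring1.
by split; [exact: (primeN1 hP) | rewrite divr1].
Qed.

Lemma loc_inv x : S x -> ~ P x -> A x^-1.
Proof.
move=> Sx nPx; exists 1, x; split; first exact: subring1.
by split=> //; split=> //; rewrite mul1r.
Qed.

Lemma loc_subring : is_subring A.
Proof.
split; first by apply: loc_incl; exact: subring1.
split=> _ _ [a [s [Sa [Ss [Ps ->]]]]] [b [t [Sb [St [Pt ->]]]]].
- exists (a * t - b * s), (s * t); split.
    by apply: subringB => //; apply: subringM.
  split; first exact: subringM.
  split; first exact: (prime_notinM hP).
  by field; rewrite !Pn0.
- exists (a * b), (s * t); split; first exact: subringM.
  split; first exact: subringM.
  split; first exact: (prime_notinM hP).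
  by field; rewrite !Pn0.
Qed.

Lemma loc_ideal_prime Q : is_prime S Q -> (forall x, Q x -> P x) ->
  is_prime A (loc_ideal S P Q).
Proof.
move=> hQ QP; split; first split.
- move=> _ [a [s [Qa [Ss [Ps ->]]]]]; exists a, s; split=> //.
  exact: (primeW hQ).
- split.
    exists 0, 1; split; first exact: (prime0 hQ).
    by split; [exact: subring1 | split; [exact: (primeN1 hP)| rewrite mul0r]].
  split.
    move=> _ _ [a [s [Qa [Ss [Ps ->]]]]] [b [t [Qb [St [Pt ->]]]]].
    exists (a * t + b * s), (s * t); split.
      by apply: (primeD hQ); apply: (primeMr hQ).
    split; first exact: subringM.
    split; first exact: (prime_notinM hP).
    by field; rewrite !Pn0.
  move=> _ _ [b [t [Sb [St [Pt ->]]]]] [a [s [Qa [Ss [Ps ->]]]]].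
  exists (b * a), (t * s); split; first exact: (primeMl hQ).
  split; first exact: subringM.
  split; first exact: (prime_notinM hP).
  by field; rewrite !Pn0.
- split.
    move=> [a [s [Qa [Ss [Ps]]]]] /(congr1 (fun z => z * s)).
    rewrite mul1r divfK ?Pn0 // => sa; apply: Ps; rewrite sa; exact: QP.
  move=> _ _ [a [s [Sa [Ss [Ps ->]]]]] [b [t [Sb [St [Pt ->]]]]].
  move=> [c [u [Qc [Su [Pu E]]]]].
  have Eabu : (a * b) * u = c * (s * t).
    have : (a / s * (b / t)) * (s * t * u) = c / u * (s * t * u) by rewrite E.
    have [s0 t0 u0] : [/\ s != 0, t != 0 & u != 0] by rewrite !Pn0.
    have -> : a / s * (b / t) * (s * t * u) = a * b * u by field; rewrite s0 t0.
    by move=> ->; field.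
  have : Q ((a * b) * u).
    rewrite Eabu; apply: (primeMr hQ) => //; exact: subringM.
  case/(prime_mul hQ); rewrite //; first exact: subringM.
    by case/(prime_mul hQ) => // ?; [left; exists a, s | right; exists b, t].
  by move/QP.
Qed.

Lemma loc_ideal_contr Q x : is_prime S Q -> (forall y, Q y -> P y) ->
  S x -> loc_ideal S P Q x -> Q x.
Proof.
move=> hQ QP Sx [a [s [Qa [Ss [Ps E]]]]].
have : Q (x * s) by rewrite E divfK // Pn0.
by case/(prime_mul hQ) => // /QP.
Qed.

Lemma loc_ideal_incl Q x : Q x -> loc_ideal S P Q x.
Proof.
move=> Qx; exists x, 1; split=> //; split; first exact: subring1.
by split; [exact: (primeN1 hP)| rewrite divr1].
Qed.

Lemma locM_prime : is_prime A M.
Proof. exact: loc_ideal_prime. Qed.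

Lemma locM_unit x : A x -> ~ M x -> A x^-1.
Proof.
move=> [a [s [Sa [Ss [Ps ->]]]]] nM; exists s, a; split=> //; split=> //.
split; last by rewrite invf_div.
by move=> Pa; apply: nM; exists a, s.
Qed.

Lemma proper_ideal_sub_locM I : is_ideal A I -> ~ I 1 -> forall x, I x -> M x.
Proof.
move=> [IA [I0 [ID IM]]] I1 x Ix; apply: contrapT => nMx; apply: I1.
have [x0|x0] := eqVneq x 0.
  by case: nMx; rewrite x0; exact: prime0 locM_prime.
by rewrite -(mulVf x0); apply: IM => //; apply: locM_unit => //; exact: IA.
Qed.

Lemma locM_maximal : is_maximal A M.
Proof.
have hM := locM_prime; split; first by case: hM.
split; first exact: (primeN1 hM).
move=> J hJ MJ; have [J1|J1] := EM (J 1); [by right|left] => x.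
by split; [exact: proper_ideal_sub_locM | exact: MJ].
Qed.

Lemma loc_maximal_unique M' : is_maximal A M' -> forall x, M' x <-> M x.
Proof.
move=> [iM' [M'1 maxM']] x; split; first exact: proper_ideal_sub_locM.
have hM := locM_prime.
case: (maxM' M _ (proper_ideal_sub_locM iM' M'1)) => [|H /H //|M1].
  by case: hM.
by case: (primeN1 hM).
Qed.

(** An element of P outside Q would make 0, the extension of Q and the maximal ideal a strict chain
    of length two in the localization. *)
Lemma krull_le1_minimal Q x : krull_dim_le A 1 -> is_prime S Q ->
  (forall y, Q y -> P y) -> Q x -> x != 0 -> forall y, P y -> Q y.
Proof.
move=> dim1 hQ QP Qx x0 y Py; apply: contrapT => nQy; apply: dim1.
exists (fun i => match i with 0%N => fun z => z = 0 | 1%N => loc_ideal S P Q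
                 | _ => M end).
split.
  case=> [|[|i]] _; [apply: prime_zero; exact: loc_subring| | exact: locM_prime].
  exact: loc_ideal_prime.
case=> [|[|i]] //= _; split.
- by move=> z ->; apply: prime0; exact: loc_ideal_prime.
- by exists x; split; [exact: loc_ideal_incl | exact/eqP].
- move=> _ [a [s [Qa [Ss [Ps ->]]]]]; exists a, s; split=> //; exact: QP.
- exists y; split; first exact: loc_ideal_incl.
  by move/(loc_ideal_contr hQ QP) => H; apply: nQy; apply: H; exact: (primeW hP).
Qed.

(** The middle prime of a chain of length two contracts to a nonzero prime of S inside P. Minimality
    makes the contraction all of P, so the middle prime is already the maximal ideal and the last
    inclusion is not strict. *)
Lemma minimal_krull_le1 :
  (forall Q x, is_prime S Q -> (forall y, Q y -> P y) -> Q x -> x != 0 ->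
     forall y, P y -> Q y) ->
  krull_dim_le A 1.
Proof.
move=> minP [q [qp qlt]].
have qM i : (i <= 2)%N -> forall x, q i x -> M x.
  by move=> /qp [qi [q1 _]]; exact: proper_ideal_sub_locM.
have [q01 [z [q1z nq0z]]] := qlt 0%N isT.
have [q12 [w [q2w nq1w]]] := qlt 1%N isT.
have h1 : is_prime A (q 1%N) by exact: qp.
have h0 : is_prime A (q 0%N) by exact: qp.
apply: nq1w.
have [a [s [Pa [Ss [Ps Ew]]]]] := qM 2%N isT _ q2w.
pose Q x := S x /\ q 1%N x.
have hQ : is_prime S Q.
  split; first split.
  - by move=> ? [].
  - split; first by split; [exact: subring0 | exact: (prime0 h1)].
    split=> [x y [Sx qx] [Sy qy]|r x Sr [Sx qx]].
      by split; [exact: subringD | exact: (primeD h1)].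
    by split; [exact: subringM | apply: (primeMl h1) => //; exact: loc_incl].
  - split; first by case=> _ /(primeN1 h1).
    move=> x y Sx Sy [_ /(prime_mul h1 (loc_incl Sx) (loc_incl Sy))].
    by case; [left|right].
have QP x : Q x -> P x.
  move=> [Sx /(qM 1%N isT) Mx]; apply: (loc_ideal_contr hP _ Sx Mx); exact: id.
have [b [t [Pb [St [Pt Ez]]]]] := qM 1%N isT _ q1z.
have Sb := primeW hP Pb.
have Qb : Q b.
  split=> //; have -> : b = t * z by rewrite Ez mulrC divfK // Pn0.
  by apply: (primeMl h1) => //; exact: loc_incl.
have b0 : b != 0.
  apply/eqP => b0; apply: nq0z; rewrite Ez b0 mul0r; exact: (prime0 h0).
have [_ q1a] := minP Q b hQ QP Qb b0 a Pa.
rewrite Ew mulrC; apply: (primeMl h1) => //; exact: loc_inv.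
Qed.

Lemma gen_by1 (a : F) x : gen_by A (fun _ : 'I_1 => a) x <-> exists2 r, A r & x = r * a.
Proof.
split=> [[r [Ar ->]]|[r Ar ->]].
  by exists (r ord0) => //; rewrite big_ord1.
by exists (fun=> r); split=> //; rewrite big_ord1.
Qed.

(** The nonzero x makes 0 < M a chain of primes, so the dimension is exactly 1, the number of
    generators. *)
Lemma regular_of_principal x a : krull_dim_le A 1 -> P x -> x != 0 ->
  (forall y, M y <-> exists2 r, A r & y = r * a) -> regular_local A.
Proof.
move=> dim1 Px x0 Ma; exists M; split; first exact: locM_maximal.
split; first exact: loc_maximal_unique.
exists 1%N; split.
  split=> //; exists (fun i => if i is 0%N then fun z => z = 0 else M); split.
    case=> [|i] _; [apply: prime_zero; exact: loc_subring|exact: locM_prime].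
  case=> // _; split; first by move=> z ->; exact: prime0 locM_prime.
  by exists x; split; [exact: loc_ideal_incl | exact/eqP].
by exists (fun=> a) => y; rewrite gen_by1.
Qed.

Lemma regular_of_zero : (forall x, P x -> x = 0) -> regular_local A.
Proof.
move=> P0; exists M; split; first exact: locM_maximal.
split; first exact: loc_maximal_unique.
have M0 x : M x -> x = 0.
  by move=> [a [s [/P0 -> [_ [_ ->]]]]]; rewrite mul0r.
exists 0%N; split.
  split.
    exists (fun _ z => z = 0); split=> // i _.
    apply: prime_zero; exact: loc_subring.
  move=> [q [qp qlt]]; have [q01 [z [q1z nq0z]]] := qlt 0%N isT.
  have [qi [q1 _]] := qp 1%N isT.
  apply: nq0z; rewrite (M0 _ (proper_ideal_sub_locM qi q1 q1z)).
  by apply: prime0; exact: qp.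
exists (fun=> 0) => x; split.
  by move=> /M0 ->; exists (fun=> 0); split=> [[]|] //; rewrite big_ord0.
by case=> r [_ ->]; rewrite big_ord0; exact: prime0 locM_prime.
Qed.

(** The number of generators is the dimension d, which is at most 1; d = 0 would force the maximal
    ideal to be 0, against x. *)
Lemma regular_principal x : krull_dim_le A 1 -> regular_local A ->
  P x -> x != 0 -> exists2 a, M a & forall y, M y -> exists2 r, A r & y = r * a.
Proof.
move=> dim1 [M' [maxM' [_ [d [[chd _] [a Ma]]]]]] Px x0.
have MM' y := loc_maximal_unique maxM' y.
case: d => [|[|d]] in chd a Ma *.
- have /MM'/Ma [r [_]] : M x by exact: loc_ideal_incl.
  by rewrite big_ord0 => /eqP; rewrite (negbTE x0).
- exists (a ord0).
    apply/MM'/Ma; exists (fun=> 1); split; last by rewrite big_ord1 mul1r.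
    by move=> _; apply: loc_incl; exact: subring1.
  move=> y /MM'/Ma [r [Ar ->]]; exists (r ord0) => //; by rewrite big_ord1.
- case: dim1; case: chd => q [qp qlt]; exists q; split.
    by move=> i i2; apply: qp; apply: leq_trans i2 _.
  by move=> i i2; apply: qlt; apply: leq_trans i2 _.
Qed.

End AtPrime.
End Localization.

(** * Laurent polynomials by their exponents *)

Section Span.
Variables (k : fieldType) (n : nat).
Notation F := (LFrac k n).
Notation vec := 'rV[int]_n.
Implicit Types (a b : vec) (D E : vec -> Prop).

Definition lX a : F := lmono (fun i => a 0 i).
Definition lC (c : k) : F := FracField.tofrac (c%:MP).

Lemma lvar_neq0 i : FracField.tofrac ('X_i : {mpoly k[n]}) != 0.
Proof.
rewrite tofrac_eq0; apply/eqP => /(congr1 (mcoeff U_(i)%MM)).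
by rewrite mcoeffXU eqxx mcoeff0 => /eqP; rewrite oner_eq0.
Qed.

Lemma lX_eq (f : 'I_n -> int) a : (forall i, f i = a 0 i) -> lmono f = lX a.
Proof. by move=> e; apply: eq_bigr => i _; rewrite e. Qed.

Lemma lX0 : lX 0 = 1.
Proof. by rewrite /lX /lmono big1 // => i _; rewrite mxE expr0z. Qed.

Lemma lXD a b : lX (a + b) = lX a * lX b.
Proof.
rewrite /lX /lmono -big_split; apply: eq_bigr => i _ /=.
by rewrite mxE expfzDr // lvar_neq0.
Qed.

Lemma lX_neq0 a : lX a != 0.
Proof. by apply/prodf_neq0 => i _; rewrite expfz_neq0 // lvar_neq0. Qed.

Lemma lXN a : lX (- a) = (lX a)^-1.
Proof.
by apply: (mulfI (lX_neq0 a)); rewrite -lXD subrr lX0 mulfV // lX_neq0.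
Qed.

Lemma lXB a b : lX (a - b) = lX a / lX b.
Proof. by rewrite lXD lXN. Qed.

Lemma lXMn a m : lX (a *+ m) = lX a ^+ m.
Proof. by elim: m => [|m IH]; rewrite ?mulr0n ?lX0 // mulrS lXD IH exprS. Qed.

Lemma lC0 : lC 0 = 0. Proof. by rewrite /lC mpolyC0 tofrac0. Qed.
Lemma lC1 : lC 1 = 1. Proof. by rewrite /lC mpolyC1 tofrac1. Qed.
Lemma lCM c d : lC (c * d) = lC c * lC d.
Proof. by rewrite /lC mpolyCM tofracM. Qed.
Lemma lCN c : lC (- c) = - lC c.
Proof. by rewrite /lC mpolyCN tofracN. Qed.

(** The k-subspace spanned by the monomials with exponents in D. Only the allowed exponents are
    recorded, never coefficients: supports, degrees and cosets are then compared by comparing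
    predicates. *)
Inductive span D : F -> Prop :=
  | span0 : span D 0
  | span_cons c a x : D a -> span D x -> span D (lC c * lX a + x).

Lemma span_mono D E x : (forall a, D a -> E a) -> span D x -> span E x.
Proof. by move=> DE; elim=> [|c a y Da _ IH]; constructor=> //; exact: DE. Qed.

Lemma spanX D a : D a -> span D (lX a).
Proof. by move=> Da; rewrite -[lX a]addr0 -[lX a]mul1r -lC1; do !constructor. Qed.

Lemma spanD D x y : span D x -> span D y -> span D (x + y).
Proof.
by move=> Dx Dy; elim: Dx => [|c a z Da _ IH]; rewrite ?add0r // -addrA; constructor.
Qed.

Lemma spanMX D E c a x : (forall b, D b -> E (a + b)) -> span D x ->
  span E (lC c * lX a * x).
Proof.
move=> DE; elim=> [|d b y Db _ IH]; first by rewrite mulr0; constructor.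
have -> : lC c * lX a * (lC d * lX b + y) =
  lC (c * d) * lX (a + b) + lC c * lX a * y by rewrite lCM lXD; ring.
by constructor=> //; exact: DE.
Qed.

Lemma span_shift D E a x : (forall b, D b -> E (a + b)) -> span D x ->
  span E (lX a * x).
Proof. by move=> DE Dx; rewrite -[lX a]mul1r -lC1; exact: spanMX Dx. Qed.

Lemma spanM D E G x y : (forall a b, D a -> E b -> G (a + b)) ->
  span D x -> span E y -> span G (x * y).
Proof.
move=> DEG Dx Ey; elim: Dx => [|c a z Da _ IH]; first by rewrite mul0r; constructor.
rewrite mulrDl; apply: spanD => //.
by apply: spanMX Ey => b; exact: DEG.
Qed.

Lemma spanN D x : span D x -> span D (- x).
Proof.
elim=> [|c a y Da _ IH]; first by rewrite oppr0; constructor.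
by rewrite opprD -mulNr -lCN; constructor.
Qed.

Lemma spanB D x y : span D x -> span D y -> span D (x - y).
Proof. by move=> Dx Dy; apply: spanD => //; exact: spanN. Qed.

Lemma span_split D E x : span D x ->
  exists y z, [/\ span (fun a => D a /\ E a) y, span (fun a => D a /\ ~ E a) z & x = y + z].
Proof.
elim=> [|c a x' Da _ [y [z [Ey Ez ->]]]].
  by exists 0, 0; rewrite addr0; split=> //; constructor.
have [Ea|nEa] := EM (E a).
- exists (lC c * lX a + y), z; rewrite addrA; split=> //; by constructor.
- exists y, (lC c * lX a + z); rewrite addrCA; split=> //; by constructor.
Qed.

Lemma span_seq D x : span D x -> exists s : seq (k * vec),
  (forall p, p \in s -> D p.2) /\ x = \sum_(p <- s) lC p.1 * lX p.2.
Proof.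
elim=> [|c a y Da _ [s [Ds ->]]]; first by exists [::]; rewrite big_nil.
exists ((c, a) :: s); rewrite big_cons; split=> // p.
by rewrite inE => /orP [/eqP ->|/Ds].
Qed.

Definition shift_mnm (N : nat) a : 'X_{1..n} := [multinom absz (a ord0 i + N%:Z)%R | i < n].
Definition shiftable (N : nat) a := forall i, 0 <= a 0 i + N%:Z.

Lemma lX_shift N a : shiftable N a ->
  lX a * lX (const_mx N%:Z) = FracField.tofrac 'X_[shift_mnm N a].
Proof.
move=> aN; rewrite -lXD /lX /lmono mpolyXE_id rmorph_prod; apply: eq_bigr => i _.
by rewrite !mxE mnmE rmorphXn /= exprnP gez0_abs.
Qed.

Lemma shift_mnm_inj N a b : shiftable N a -> shiftable N b ->
  shift_mnm N a = shift_mnm N b -> a = b.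
Proof.
move=> aN bN /mnmP eab; apply/rowP => i; have := eab i; rewrite !mnmE.
have H (x y : int) : 0 <= x + N%:Z -> 0 <= y + N%:Z ->
  absz (x + N%:Z) = absz (y + N%:Z) -> x = y by lia.
by apply: H; [exact: aN | exact: bN].
Qed.

Lemma shiftable_seq (s : seq (k * vec)) :
  exists N, forall p, p \in s -> shiftable N p.2.
Proof.
exists (\sum_(p <- s) \sum_i absz (p.2 ord0 i))%N => p ps i.
have : (absz (p.2 ord0 i) <= \sum_(q <- s) \sum_j absz (q.2 ord0 j))%N.
  rewrite (big_rem p ps) /= (bigD1 i) //= -addnA; exact: leq_addr.
have H (x : int) m : (absz x <= m)%N -> 0 <= x + m%:Z by lia.
exact: H.
Qed.

(** Linear independence of Laurent monomials in a form free of coefficients. A large monomial factor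
    turns both expressions of x into ordinary polynomials; a monomial of the first does not occur in
    the second, so its coefficient is 0. *)
Lemma span_disjoint D E x : span D x -> span E x ->
  (forall a, D a -> E a -> False) -> x = 0.
Proof.
move=> /span_seq [s [Ds xs]] /span_seq [t [Et xt]] dis.
have [N hN] := shiftable_seq (s ++ t).
have sN p : p \in s -> shiftable N p.2 by move=> ps; apply: hN; rewrite mem_cat ps.
have tN p : p \in t -> shiftable N p.2.
  by move=> pt; apply: hN; rewrite mem_cat pt orbT.
pose P (u : seq (k * vec)) : {mpoly k[n]} :=
  \sum_(p <- u) (p.1)%:MP * 'X_[shift_mnm N p.2].
have PE u : (forall p, p \in u -> shiftable N p.2) ->
    (\sum_(p <- u) lC p.1 * lX p.2) * lX (const_mx N%:Z) = FracField.tofrac (P u).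
  move=> uN; rewrite /P mulr_suml [RHS]rmorph_sum /= !big_seq; apply: eq_bigr => p pu.
  by rewrite -mulrA lX_shift; [rewrite [RHS]tofracM | exact: uN].
have Pst : P s = P t.
  by apply/eqP; rewrite -tofrac_eq; apply/eqP; rewrite -!PE // -xs -xt.
have P0 : P s = 0.
  apply/mpolyP => m; rewrite mcoeff0.
  have [/hasP [p ps /eqP pm]|/hasPn nos] := boolP (has (fun p => shift_mnm N p.2 == m) s).
    rewrite Pst raddf_sum big_seq big1 //= => q qt.
    rewrite mcoeffCM mcoeffX; case: eqP; last by rewrite mulr0.
    rewrite -pm => /(shift_mnm_inj (tN _ qt) (sN _ ps)) qp.
    by case: (dis p.2); [exact: Ds | rewrite -qp; exact: Et].
  rewrite raddf_sum big_seq big1 //= => q /nos qm.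
  by rewrite mcoeffCM mcoeffX (negbTE qm) mulr0.
apply: (mulIf (lX_neq0 (const_mx N%:Z))).
by rewrite xs PE // P0 tofrac0 mul0r.
Qed.

Lemma span_split_eq D E y z y' z' :
  span D y -> span D y' -> span E z -> span E z' ->
  (forall a, D a -> E a -> False) -> y + z = y' + z' -> y = y' /\ z = z'.
Proof.
move=> Dy Dy' Ez Ez' dis e.
have e2 : y - y' = z' - z.
  by apply/eqP; rewrite subr_eq addrAC eq_sym subr_eq eq_sym addrC -e addrC.
have y0 : y - y' = 0.
  apply: (span_disjoint (D := D) (E := E)) dis; first exact: spanB.
  by rewrite e2; exact: spanB.
by split; apply/eqP; rewrite -subr_eq0 ?y0 // -opprB -e2 y0 oppr0.
Qed.


Inductive NN (V : vec -> Prop) : vec -> Prop :=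
  | NN0 : NN V 0
  | NNS v a : V v -> NN V a -> NN V (v + a).

Inductive ZZ (V : vec -> Prop) : vec -> Prop :=
  | ZZ0 : ZZ V 0
  | ZZS v a : V v -> ZZ V a -> ZZ V (v + a)
  | ZZP v a : V v -> ZZ V a -> ZZ V (a - v).

Section Lattice.
Variable V : vec -> Prop.

Lemma NN_gen v : V v -> NN V v.
Proof. by move=> Vv; rewrite -[v]addr0; do !constructor. Qed.

Lemma NND a b : NN V a -> NN V b -> NN V (a + b).
Proof. by move=> Va Vb; elim: Va => [|v c Vv _ IH]; rewrite ?add0r // -addrA; constructor. Qed.

Lemma NNMn a m : NN V a -> NN V (a *+ m).
Proof. by move=> Va; elim: m => [|m IH]; rewrite ?mulrS; [constructor | exact: NND]. Qed.

Lemma NN_ZZ a : NN V a -> ZZ V a.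
Proof. by elim=> [|v c Vv _ IH]; constructor. Qed.

Lemma ZZ_gen v : V v -> ZZ V v.
Proof. by move=> Vv; apply: NN_ZZ; exact: NN_gen. Qed.

Lemma ZZD a b : ZZ V a -> ZZ V b -> ZZ V (a + b).
Proof.
move=> Va Vb; elim: Va => [|v c Vv _ IH|v c Vv _ IH]; rewrite ?add0r // -?addrA.
  by constructor.
by rewrite [- v + b]addrC addrA; apply: ZZP.
Qed.

Lemma ZZN a : ZZ V a -> ZZ V (- a).
Proof.
elim=> [|v c Vv _ IH|v c Vv _ IH]; first by rewrite oppr0; constructor.
  by rewrite opprD addrC; apply: ZZP.
by rewrite opprB; apply: ZZS.
Qed.

Lemma ZZB a b : ZZ V a -> ZZ V b -> ZZ V (a - b).
Proof. by move=> Va Vb; apply: ZZD => //; exact: ZZN. Qed.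

Lemma ZZMn a m : ZZ V a -> ZZ V (a *+ m).
Proof. by move=> Va; elim: m => [|m IH]; rewrite ?mulrS; [constructor | exact: ZZD]. Qed.

Lemma ZZMz a (m : int) : ZZ V a -> ZZ V (a *~ m).
Proof.
by move=> Va; case: m => m; rewrite ?NegzE ?mulrNz -pmulrn ?[ZZ V _]/=; [|apply: ZZN]; exact: ZZMn.
Qed.

Lemma ZZ_sum (I : Type) (r : seq I) (p : pred I) (f : I -> vec) :
  (forall i, p i -> ZZ V (f i)) -> ZZ V (\sum_(i <- r | p i) f i).
Proof. by move=> Vf; elim/big_ind: _ => //; [exact: ZZ0 | exact: ZZD]. Qed.

Lemma ZZ_diff a : ZZ V a -> exists u v, [/\ NN V u, NN V v & a = u - v].
Proof.
elim=> [|w c Vw _ [u [v [Nu Nv ->]]]|w c Vw _ [u [v [Nu Nv ->]]]].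
- by exists 0, 0; rewrite subr0; split=> //; exact: NN0.
- by exists (w + u), v; rewrite addrA; split=> //; exact: NNS.
- by exists u, (w + v); split=> //; [exact: NNS | rewrite opprD addrA addrAC].
Qed.

End Lattice.

Lemma NN_incl (V U : vec -> Prop) : (forall v, V v -> NN U v) -> forall a, NN V a -> NN U a.
Proof. by move=> VU a; elim=> [|v c /VU Uv _ IH]; [exact: NN0 | exact: NND]. Qed.

Lemma ZZ_incl (V U : vec -> Prop) : (forall v, V v -> ZZ U v) -> forall a, ZZ V a -> ZZ U a.
Proof.
by move=> VU a; elim=> [|v c /VU Uv _ IH|v c /VU Uv _ IH];
  [exact: ZZ0 | exact: ZZD | exact: ZZB].
Qed.

Lemma span_NN_subring V : is_subring (span (NN V)).
Proof.
split; first by rewrite -lX0; apply: spanX; exact: NN0.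
split; first by move=> x y; exact: spanB.
by move=> x y; apply: spanM => a b; exact: NND.
Qed.

End Span.

(** * Locally principal minimal primes *)

Section RingPrime.
Variable R : idomainType.
Implicit Types (P Q : R -> Prop).

Definition ring_prime P : Prop :=
  [/\ P 0, forall x y, P x -> P y -> P (x + y), forall r x, P x -> P (r * x),
      ~ P 1 & forall a b, P (a * b) -> P a \/ P b].

Definition nonzero P : Prop := exists2 x, P x & x != 0.

Definition minimal_prime P : Prop :=
  [/\ ring_prime P, nonzero P &
   forall Q, ring_prime Q -> nonzero Q -> (forall x, Q x -> P x) -> forall x, P x -> Q x].

(** Principality of P in the localization at P, with denominators cleared so that no field of
    fractions of R is needed. *)
Definition locally_principal P : Prop :=
  exists2 p, P p & forall f, P f -> exists s q, ~ P s /\ s * f = q * p.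

Lemma ring_prime_sum P I (r : seq I) (p : pred I) (f : I -> R) : ring_prime P ->
  (forall i, p i -> P (f i)) -> P (\sum_(i <- r | p i) f i).
Proof. by move=> [P0 PD _ _ _] Pf; elim/big_ind: _. Qed.

End RingPrime.

(** A weakening of unique factorization that suffices for primes without monomials and passes from R
    to R[X] by an elementary argument. *)
Definition minimal_primes_principal (R : idomainType) : Prop :=
  forall P : R -> Prop, minimal_prime P -> locally_principal P.

Lemma minimal_primes_principal_field (k : fieldType) : minimal_primes_principal k.
Proof.
move=> P [[_ _ PM P1 _] [x Px x0] _]; case: P1.
by rewrite -(mulVf x0); exact: PM.
Qed.

Section LPPoly.
Variable R : idomainType.

Definition coef_ideal (Q : R -> Prop) (f : {poly R}) : Prop := forall i, Q f`_i.

(** Gauss's argument: if i and j are the least indices of coefficients of f and g outside Q, the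
    coefficient of index i + j of the product is, modulo Q, the product of these two. *)
Lemma coef_ideal_prime Q : ring_prime Q -> ring_prime (coef_ideal Q).
Proof.
move=> hQ; have [Q0 QD QM Q1 Qp] := hQ; split.
- by move=> i; rewrite coef0.
- by move=> f g Qf Qg i; rewrite coefD; exact: QD.
- move=> f g Qg i; rewrite coefM; apply: ring_prime_sum => // j _; exact: QM.
- by move=> /(_ 0%N); rewrite coef1.
- move=> f g Qfg; have [|nf] := EM (coef_ideal Q f); [by left|right].
  apply: contrapT => ng.
  have minex (h : {poly R}) : ~ coef_ideal Q h ->
      exists2 i, ~ Q h`_i & forall j, (j < i)%N -> Q h`_j.
    move=> /existsNP [i0 ni0].
    have ex : exists i, `[< ~ Q h`_i >] by exists i0; apply/asboolP.
    exists (ex_minn ex); case: ex_minnP => i /asboolP // ni mini j ji.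
    apply: contrapT => nj; have /mini : `[< ~ Q h`_j >] by apply/asboolP.
    by rewrite leqNgt ji.
  have [i ni mi] := minex f nf; have [j nj mj] := minex g ng.
  have := Qfg (i + j)%N; rewrite coefM.
  have i_lt : (i < (i + j).+1)%N by rewrite ltnS leq_addr.
  rewrite (bigD1 (Ordinal i_lt)) //= addKn => Qs.
  have [] : Q f`_i \/ Q g`_j; [|by []|by []].
  apply: (Qp); rewrite -[f`_i * _](addrK (\sum_(l < (i + j).+1 | l != Ordinal i_lt) f`_l * g`_(i + j - l))).
  apply: (QD) => //; rewrite -mulN1r; apply: (QM); apply: ring_prime_sum => // l nl.
  have [li|il] := ltnP l i; first by rewrite mulrC; apply: (QM); exact: mi.
  apply: (QM); apply: mj.
  have : (nat_of_ord l != i)%N by apply: contra nl => /eqP li; apply/eqP/val_inj.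
  by have := ltn_ord l; lia.
Qed.

(* Either [P] is extended from [P] cut down to [R], or [P] meets [R] in 0 and is
   generated, up to leading coefficients, by an element of least degree. *)
Lemma minimal_primes_principal_poly : minimal_primes_principal R -> minimal_primes_principal {poly R}.
Proof.
move=> LPR P [hP [f0 Pf0 f00] minP]; have [P0 PD PM P1 Pp] := hP.
have [[c Pc c0]|nc] := EM (exists2 c, P c%:P & c != 0).
- pose P0' c := P c%:P.
  have hP0 : ring_prime P0'.
    split=> //.
    - by move=> x y; rewrite /P0' polyCD; exact: PD.
    - by move=> r x; rewrite /P0' polyCM; exact: PM.
    - by move=> x y; rewrite /P0' polyCM; exact: Pp.
  have extP Q : ring_prime Q -> nonzero Q -> (forall x, Q x -> P0' x) ->
      forall f, P f -> coef_ideal Q f.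
    move=> hQ [d Qd d0] QP; apply: minP; first exact: coef_ideal_prime.
      exists d%:P; last by rewrite polyC_eq0.
      by case: hQ => Q0 _ _ _ _ i; rewrite coefC; case: eqP.
    move=> f Qf; rewrite -[f]coefK poly_def; apply: ring_prime_sum => // i _.
    by rewrite -mul_polyC mulrC; apply: (PM); exact: QP.
  have nz0 : nonzero P0' by exists c.
  have [|p Pp0 Hp] := LPR P0'.
    split=> // Q hQ nzQ QP x Px.
    by have := extP Q hQ nzQ QP _ Px 0%N; rewrite coefC.
  exists p%:P => // f /(extP _ hP0 nz0 (fun x h => h)) Pf.
  (* Denominators are collected coefficient by coefficient: s serves the higher part f, t the
     constant term d. *)
  elim/poly_ind: f Pf => [|f d IH] Pf.
    by exists 1, 0; rewrite mulr0 mul0r.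
  have [|s [q [ns E]]] := IH.
    by move=> i; have := Pf i.+1; rewrite coefD coefMX coefC addr0.
  have Pd : P0' d by have := Pf 0%N; rewrite coefD coefMX coefC /= add0r.
  have [t [r [nt Et]]] := Hp _ Pd.
  exists (s * t%:P), (q * 'X * t%:P + s * r%:P); split; first by case/Pp.
  have -> : s * t%:P * (f * 'X + d%:P) = (s * f) * 'X * t%:P + s * (t * d)%:P.
    by rewrite polyCM; ring.
  by rewrite E Et polyCM; ring.
- have ex : exists m, `[< exists2 f, P f & (f != 0) && (size f == m) >].
    by exists (size f0); apply/asboolP; exists f0 => //; rewrite f00 eqxx.
  case: (ex_minnP ex) => m /asboolP [p Ppp /andP [p0 /eqP sp]] minm.
  exists p => // f Pf.
  exists (lead_coef p ^+ scalp f p)%:P, (f %/ p); split.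
    by move=> Pl; apply: nc; eexists; [exact: Pl | rewrite expf_neq0 // lead_coef_eq0].
  rewrite mul_polyC Pdiv.Idomain.divp_eq.
  suff -> : f %% p = 0 by rewrite addr0.
  apply/eqP; apply: contrapT => /negP r0.
  have Pr : P (f %% p).
    have -> : f %% p = (lead_coef p ^+ scalp f p)%:P * f + - (f %/ p) * p.
      by rewrite mul_polyC Pdiv.Idomain.divp_eq; ring.
    by apply: (PD); exact: PM.
  have /minm : `[< exists2 g, P g & (g != 0) && (size g == size (f %% p)) >].
    by apply/asboolP; exists (f %% p); rewrite // r0 eqxx.
  by rewrite -sp leqNgt ltn_modp p0.
Qed.

End LPPoly.

(** * Bases of sublattices of Z^n by Euclidean elimination *)

Section LatticeBasis.
Variable n : nat.
Notation vec := 'rV[int]_n.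
Implicit Types (a b u v : vec) (s t : seq vec).

Definition lat s := ZZ (fun v => v \in s).
Definition cone s := NN (fun v => v \in s).

Definition same_lat s t := forall a, lat s a <-> lat t a.

Lemma same_lat_trans s t r : same_lat s t -> same_lat t r -> same_lat s r.
Proof. by move=> st tr a; rewrite (st a). Qed.

Lemma same_latP s t : (forall v, v \in s -> lat t v) -> (forall v, v \in t -> lat s v) ->
  same_lat s t.
Proof. by move=> st ts a; split; exact: ZZ_incl. Qed.

Lemma lat_mem s v : v \in s -> lat s v.
Proof. exact: ZZ_gen. Qed.

Lemma lat_sub s t : {subset s <= t} -> forall a, lat s a -> lat t a.
Proof. by move=> st; apply: ZZ_incl => v /st; exact: lat_mem. Qed.

Lemma same_lat_cons v s t : same_lat s t -> same_lat (v :: s) (v :: t).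
Proof.
move=> st; apply: same_latP => u; rewrite inE => /orP [/eqP ->|us].
- by apply: lat_mem; rewrite mem_head.
- by apply: (@lat_sub t); [move=> x xt; rewrite inE xt orbT | apply/st; exact: lat_mem].
- by apply: lat_mem; rewrite mem_head.
- by apply: (@lat_sub s); [move=> x xt; rewrite inE xt orbT | apply/st; exact: lat_mem].
Qed.

Lemma cone_cons v s a : cone (v :: s) a <-> exists m, cone s (a - v *+ m).
Proof.
split.
  elim=> [|w c]; first by exists 0%N; rewrite mulr0n subr0; exact: NN0.
  rewrite inE => /orP [/eqP ->|ws] _ [j lj].
    by exists j.+1; rewrite mulrS opprD addrACA subrr add0r.
  by exists j; rewrite -addrA; exact: NNS.
move=> [m lm]; rewrite -[a](subrK (v *+ m)); apply: NND.
  by apply: NN_incl lm => x xs; apply: NN_gen; rewrite inE xs orbT.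
by apply: NNMn; apply: NN_gen; rewrite mem_head.
Qed.

(** Linear independence over the integers, peeled from the head: this makes the monomial of the head
    a free variable over the ring of the tail in [poly_model]. *)
Fixpoint indep s : Prop :=
  if s is v :: s' then (forall j : int, lat s' (v *~ j) -> j = 0) /\ indep s' else True.

(** The Euclidean algorithm on the i-th coordinates, by induction on the absolute value of the
    second: u is replaced by its remainder and the two vectors change places. *)
Lemma lat_euclid (i : 'I_n) u v s : exists u' v',
  v' ord0 i = 0 /\ same_lat (u :: v :: s) (u' :: v' :: s).
Proof.
have [m] := ubnP (absz (v ord0 i)); elim: m u v => // m IH u v lt_v.
have [v0|v0] := eqVneq (v ord0 i) 0; first by exists u, v.
set q := (u ord0 i %/ v ord0 i)%Z.
have [|u' [v' [v'0 E]]] := IH v (u - v *~ q).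
  rewrite -ltnS; apply: leq_trans _ lt_v; rewrite ltnS.
  have -> : (u - v *~ q) ord0 i = (u ord0 i %% v ord0 i)%Z.
    by rewrite -scaler_int !mxE intz.
  have := ltz_mod (u ord0 i) v0; have := modz_ge0 (u ord0 i) v0; lia.
exists u', v'; split=> //; apply: same_lat_trans _ E; apply: same_latP => w; rewrite !inE.
- move=> /or3P [/eqP->|/eqP->|ws].
  + rewrite -[X in lat _ X](subrK (v *~ q)); apply: ZZD; last apply: ZZMz.
      by apply: lat_mem; rewrite !inE eqxx orbT.
    by apply: lat_mem; rewrite !inE eqxx.
  + by apply: lat_mem; rewrite !inE eqxx.
  + by apply: lat_mem; rewrite !inE ws !orbT.
- move=> /or3P [/eqP->|/eqP->|ws].
  + by apply: lat_mem; rewrite !inE eqxx orbT.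
  + apply: ZZB; last apply: ZZMz; apply: lat_mem; rewrite !inE eqxx ?orbT //.
  + by apply: lat_mem; rewrite !inE ws !orbT.
Qed.

Definition zero_from (m : nat) v := forall i : 'I_n, (m <= i)%N -> v ord0 i = 0.

Lemma zero_from_lat m s : (forall v, v \in s -> zero_from m v) ->
  forall a, lat s a -> zero_from m a.
Proof.
move=> zs a; elim=> [|v c /zs zv _ zc|v c /zs zv _ zc] i mi; rewrite !mxE //.
  by rewrite zv // zc.
by rewrite zv // zc.
Qed.

Lemma lat_column (i : 'I_n) s : exists u t,
  same_lat s (u :: t) /\ forall v, v \in t -> v ord0 i = 0.
Proof.
elim: s => [|v s [u [t [st t0]]]].
  exists 0, [::]; split=> //; apply: same_latP => // v.
  by rewrite inE => /eqP ->; exact: ZZ0.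
have [v' [u' [u'0 E]]] := lat_euclid i v u t.
exists v', (u' :: t); split; first exact: same_lat_trans (same_lat_cons v st) E.
by move=> w; rewrite inE => /orP [/eqP ->|/t0].
Qed.

(** Echelon reduction from the last coordinate down; at stage m all vectors vanish from coordinate m
    on. One vector u keeps the pivot, and a multiple of u in the lattice of the others has pivot
    coordinate 0, hence is the zero multiple. *)
Lemma lattice_basis s : exists2 t, indep t & same_lat s t.
Proof.
suff H m : (m <= n)%N -> forall s, (forall v, v \in s -> zero_from m v) ->
    exists2 t, indep t & same_lat s t.
  by apply: (H n (leqnn n)) => v _ i; rewrite leqNgt ltn_ord.
elim: m => [|m IH] mn {}s zs.
  exists [::] => //; apply: same_latP => // v /zs v0.
  have -> : v = 0 by apply/rowP => i; rewrite mxE; apply: v0.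
  exact: ZZ0.
pose i := Ordinal mn.
have [u [t [st t0]]] := lat_column i s.
have zut v : v \in u :: t -> zero_from m.+1 v.
  by move=> vt; apply: (zero_from_lat zs); apply/st; exact: lat_mem.
have zt v : v \in t -> zero_from m v.
  move=> vt j; rewrite leq_eqVlt => /orP [/eqP mj|mj].
    by rewrite -(t0 v vt); congr (v _ _); apply: val_inj.
  by apply: zut => //; rewrite inE vt orbT.
have [t' it' tt'] := IH (ltnW mn) t zt.
have [u0|u0] := eqVneq (u ord0 i) 0.
  (* With pivot 0 every vector of s vanishes at coordinate m as well, so s itself is one stage
     further down. *)
  apply: (IH (ltnW mn)) => v vs; move/st: (lat_mem vs).
  apply: zero_from_lat => w; rewrite inE => /orP [/eqP -> j|/zt //].
  rewrite leq_eqVlt => /orP [/eqP mj|mj].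
    by rewrite -u0; congr (u _ _); apply: val_inj.
  by apply: (zut u) => //; rewrite mem_head.
exists (u :: t'); last exact: same_lat_trans st (same_lat_cons u tt').
split=> // j /tt' /(zero_from_lat zt) /(_ i (leqnn _)).
by rewrite -scaler_int mxE intz => /eqP; rewrite mulf_eq0 (negbTE u0) orbF => /eqP.
Qed.

End LatticeBasis.

(** * Primes that contain no monomial *)

Lemma cross_mul (K : fieldType) (a b c d : K) : d != 0 ->
  b * (d * c * (a / d)) = c * (a * b).
Proof. by move=> d0; field. Qed.

Lemma cross_div (K : fieldType) (a b d f p q : K) : d != 0 -> f != 0 -> b != 0 ->
  f * (a * b) = q * p -> a / d = q * (f^-1 * (b^-1 * d^-1)) * p.
Proof.
move=> d0 f0 b0 E; have -> : a = q * p / (f * b) by rewrite -E; field; rewrite f0 b0.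
by field; rewrite d0 f0 b0.
Qed.

Section Laurent.
Variables (k : fieldType) (n : nat).
Notation F := (LFrac k n).
Notation vec := 'rV[int]_n.
Implicit Types (a b u v : vec) (s t : seq vec) (x y z : F).
Notation lX := (@lX k n).
Notation span := (@span k n).

(** The semigroup ring of an independent family is a polynomial ring, built one variable at a time
    by sending X to the monomial of the head. *)
Lemma poly_model t : indep t -> exists (R : idomainType) (phi : {rmorphism R -> F}),
  [/\ minimal_primes_principal R, injective phi, forall f, span (cone t) (phi f) &
      forall x, span (cone t) x -> exists f, x = phi f].
Proof.
elim: t => [_|b t IH [b_ind t_ind]].
  pose phi : {rmorphism k -> F} := (@FracField.tofrac {mpoly k[n]} \o @mpolyC n k).
  exists k, phi; split; first exact: minimal_primes_principal_field.
  - exact: fmorph_inj.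
  - move=> c; rewrite -[phi c]addr0 -[phi c]mulr1 -(lX0 k n).
    by constructor; [exact: NN0 | constructor].
  - move=> x; elim=> [|c a y ca _ [f ->]]; first by exists 0; rewrite rmorph0.
    have -> : a = 0 by case: ca => // v w; rewrite in_nil.
    by exists (c + f); rewrite lX0 mulr1 rmorphD.
have [R [phi [LPR phi_inj phi_span phi_surj]]] := IH t_ind.
have [psi [psiC psiX]] : exists psi : {rmorphism {poly R} -> F},
    (forall c, psi c%:P = phi c) /\ psi 'X = lX b.
  exists (horner_eval (lX b) \o map_poly phi); split=> [c|] /=.
    by rewrite map_polyC /horner_eval hornerC.
  by rewrite map_polyX /horner_eval hornerX.
have cone_t a : cone t a -> cone (b :: t) a.
  by move=> ta; apply/cone_cons; exists 0%N; rewrite mulr0n subr0.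
have psi_span p : span (cone (b :: t)) (psi p).
  elim/poly_ind: p => [|p c IHp]; first by rewrite rmorph0; constructor.
  rewrite rmorphD rmorphM /= psiC psiX; apply: spanD.
    rewrite mulrC; apply: span_shift IHp => a ba.
    by apply: NNS => //; rewrite mem_head.
  by apply: span_mono (phi_span c).
exists {poly R}, psi; split=> //; first exact: minimal_primes_principal_poly.
- suff psi0 p : psi p = 0 -> p = 0.
    by move=> p q e; apply/eqP; rewrite -subr_eq0; apply/eqP/psi0; rewrite rmorphB e subrr.
  elim/poly_ind: p => [//|p c IHp].
  rewrite rmorphD rmorphM /= psiC psiX => e.
  (* Exponents in which b occurs with positive multiplicity. By independence none of them lies in
     the cone of the tail, so the two summands of the image of p X + c vanish separately. *)
  pose D a := exists m, cone t (a - b *+ m.+1).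
  have Dp : span D (psi p * lX b).
    rewrite mulrC; apply: span_shift (psi_span p) => a /cone_cons [m tm].
    exists m; by rewrite mulrS opprD addrACA subrr add0r.
  have dis a : D a -> cone t a -> False.
    move=> [m /NN_ZZ tam] /NN_ZZ ta.
    have /b_ind // : lat t (b *~ m.+1).
    have -> : b *~ m.+1 = a - (a - b *+ m.+1) by rewrite opprB addrC subrK.
    exact: ZZB.
  have [] := @span_split_eq k n D (cone t) _ _ 0 0 Dp _ (phi_span c) _ dis _.
  + by constructor.
  + by constructor.
  + by rewrite e addr0.
  move=> /eqP; rewrite mulf_eq0 (negbTE (lX_neq0 _ _)) orbF => /eqP /IHp -> c0.
  by rewrite mul0r add0r (phi_inj c 0) ?rmorph0.
- move=> x; elim=> [|c a y /cone_cons [m ta] _ [f ->]]; first by exists 0; rewrite rmorph0.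
  have [|g Eg] := phi_surj (lC n c * lX (a - b *+ m)).
    by rewrite -[_ * _]addr0; constructor=> //; constructor.
  exists (g%:P * 'X^m + f); rewrite rmorphD rmorphM rmorphXn /= psiC psiX -Eg.
  by rewrite -lXMn -mulrA -lXD subrK.
Qed.

Section Torus.
Variables (s : seq vec) (P : F -> Prop).
Let S := span (cone s).
Hypothesis hP : is_prime S P.
Hypothesis P_units : forall v, v \in s -> ~ P (lX v).
Let A := localization S P.
Let hS : is_subring S := span_NN_subring k (fun v => v \in s).

Lemma torus_monomial a : cone s a -> ~ P (lX a).
Proof.
elim=> [|v b sv nb IH]; first by rewrite lX0; exact: primeN1 hP.
rewrite lXD; apply: (prime_notinM hP) => //; last exact: P_units.
  by apply: spanX; apply: NN_gen.
by apply: spanX.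
Qed.

Lemma torus_clear t x : same_lat s t -> span (lat t) x ->
  exists2 a, cone t a & span (cone t) (x * lX a).
Proof.
move=> st; elim=> [|c a y ta _ [b tb IH]].
  by exists 0; [exact: NN0 | rewrite mul0r; constructor].
have [u [v [tu tv ->]]] := ZZ_diff ta.
exists (v + b); first exact: NND.
rewrite mulrDl; apply: spanD.
  rewrite -mulrA -lXD -[_ * _]addr0; constructor; last by constructor.
  by rewrite addrA subrK; apply: NND.
by rewrite mulrC lXD -mulrA; apply: span_shift; [move=> d; exact: NND|rewrite mulrC].
Qed.

(** Monomials with exponents in the lattice of s are units of A, so s may be traded for a basis t of
    its lattice, whose semigroup ring is a polynomial ring R. A local generator of the contraction
    P' of M to R then generates M. *)
Lemma torus_regular : krull_dim_le A 1 -> regular_local A.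
Proof.
move=> dim1.
have [[x0 Px0 x00]|P0] := EM (exists2 x, P x & x != 0); last first.
  apply: regular_of_zero => // x Px; apply: contrapT => /eqP x0.
  by apply: P0; exists x.
have [t it st] := lattice_basis s.
have [R [phi [LPR phi_inj phi_span phi_surj]]] := poly_model it.
pose M := loc_ideal S P P.
have hM : is_prime A M by exact: locM_prime.
have hA : is_subring A by exact: loc_subring.
have Aunit a : lat s a -> A (lX a).
  move=> /ZZ_diff [u [v [nu nv ->]]]; exists (lX u), (lX v).
  split; first exact: spanX. split; first exact: spanX.
  by split; [exact: torus_monomial | rewrite lXB].
have Munit a : lat s a -> ~ M (lX a).
  move=> sa Ma; apply: (primeN1 hM); rewrite -(lX0 k n) -(subrr a) lXD mulrC.
  by apply: (primeMl hM) => //; apply: Aunit; exact: ZZN.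
have Alat x : span (lat s) x -> A x.
  elim=> [|c a y sa _ Ay]; first exact: subring0.
  apply: (subringD hA) => //; apply: (subringM hA); last exact: Aunit.
  apply: (loc_incl hS hP); rewrite -[lC n c]mulr1 -(lX0 k n) -[_ * _]addr0.
  by constructor; [exact: NN0 | constructor].
have Aphi f : A (phi f).
  apply: Alat; apply: span_mono (phi_span f) => a /NN_ZZ ta; exact/st.
have phiX a : cone t a -> exists f, lX a = phi f by move=> ta; apply: phi_surj; exact: spanX.
have clear x : S x -> exists a f, [/\ cone t a & x * lX a = phi f].
  move=> Sx; have [|a ta /phi_surj [f E]] := @torus_clear t x st.
    by apply: span_mono Sx => a /NN_ZZ sa; apply/st.
  by exists a, f.
have ctM a : cone t a -> ~ M (lX a) by move=> /NN_ZZ ta; apply: Munit; apply/st.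
have phi_neq0 f : f != 0 -> phi f != 0.
  by move=> f0; apply/eqP => e; case/eqP: f0; apply: phi_inj; rewrite e rmorph0.
have PM x : P x -> M x by exact: loc_ideal_incl.
have MP x : S x -> M x -> P x by move=> Sx; apply: (loc_ideal_contr hP hP).
pose P' f := M (phi f).
have hP' : ring_prime P'.
  rewrite /P'; split.
  - rewrite rmorph0; exact: (prime0 hM).
  - by move=> f g; rewrite rmorphD; exact: (primeD hM).
  - by move=> f g Mg; rewrite rmorphM; apply: (primeMl hM).
  - by rewrite rmorph1; exact: (primeN1 hM).
  - by move=> f g; rewrite rmorphM; exact: (prime_mul hM).
have [|p Pp Hp] := LPR P'.
  split=> //.
    have [a [f [ta E]]] := clear _ (primeW hP Px0).
    exists f.
      by rewrite /P' -E; apply: (primeMr hM); [exact: PM | apply: Aunit; apply/st; exact: NN_ZZ].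
    apply/eqP => f0; move: E; rewrite f0 rmorph0 => /eqP.
    by rewrite mulf_eq0 (negbTE x00) (negbTE (lX_neq0 _ _)).
  move=> Q hQ [q Qq q0] QP'.
  have [Q0 QD QM Q1 Qp] := hQ.
  have Qunit a f : cone t a -> lX a = phi f -> ~ Q f.
    by move=> ta E /QP'; rewrite /P' -E; exact: ctM.
  (* Minimality of P' is inherited from P: a nonzero prime Q of R below P' is pulled back to S by
     allowing multiplication by a monomial, and the dimension bound forces the pullback to be P. *)
  pose QS x := S x /\ exists a f, [/\ cone t a, Q f & x * lX a = phi f].
  have hQS : is_prime S QS.
    split; [split; last split; last split|split].
    - by move=> ? [].
    - split; first exact: subring0.
      by exists 0, 0; rewrite mul0r rmorph0; split=> //; exact: NN0.
    - move=> x y [Sx [a [f [ta Qf Ef]]]] [Sy [b [g [tb Qg Eg]]]].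
      split; first exact: subringD.
      have [f' Ea] := phiX a ta; have [g' Eb] := phiX b tb.
      exists (a + b), (g' * f + f' * g); split; first exact: NND.
        by apply: (QD); exact: QM.
      by rewrite rmorphD !rmorphM -Ef -Eg -Ea -Eb lXD; ring.
    - move=> r x Sr [Sx [a [f [ta Qf Ef]]]].
      split; first exact: subringM.
      have [b [g [tb Eg]]] := clear r Sr.
      exists (b + a), (g * f); split; [exact: NND|exact: QM|].
      by rewrite rmorphM -Ef -Eg lXD; ring.
    - case=> _ [a [f [ta Qf]]]; rewrite mul1r => E.
      exact: Qunit ta E Qf.
    - move=> x y Sx Sy [_ [a [f [ta Qf Ef]]]].
      have [b [g [tb Eg]]] := clear x Sx; have [c [h [tc Eh]]] := clear y Sy.
      have [f' Ea] := phiX a ta; have [g' Eb] := phiX b tb; have [h' Ec] := phiX c tc.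
      have : Q (f' * (g * h)).
        have -> : f' * (g * h) = (g' * h') * f.
          by apply: phi_inj; rewrite !rmorphM -Ef -Eg -Eh -Ea -Eb -Ec; ring.
        exact: QM.
      case/Qp; first by move/(Qunit _ _ ta Ea).
      by case/Qp => ?; [left; split=> //; exists b, g | right; split=> //; exists c, h].
  have QSP x : QS x -> P x.
    move=> [Sx [a [f [ta /QP' Qf Ef]]]]; apply: MP => //.
    have -> : x = lX (- a) * phi f by rewrite lXN -Ef mulrCA mulVf ?lX_neq0 // mulr1.
    by apply: (primeMl hM) => //; apply: Aunit; apply: ZZN; apply/st; exact: NN_ZZ.
  have PQS : forall x, P x -> QS x.
    have [a ta] : exists2 a, cone s a & span (cone s) (phi q * lX a).
      by apply: (torus_clear (t := s)) => //; apply: span_mono (phi_span q) => a /NN_ZZ ta; apply/st.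
    move=> Sqa; apply: (krull_le1_minimal hS hP dim1 hQS QSP (x := phi q * lX a)).
      split=> //; have [b [g [tb Eg]]] := clear _ (spanX k ta).
      exists b, (g * q); split=> //; first exact: QM.
      by rewrite rmorphM -Eg; ring.
    by apply: mulf_neq0; [exact: phi_neq0 | exact: lX_neq0].
  move=> f [a [d [Pa [Sd [Pd Ed]]]]].
  have [_ [b [g [tb Qg Eg]]]] := PQS a Pa.
  have [c [h [tc Eh]]] := clear d Sd.
  have [b' Eb] := phiX b tb; have [c' Ec] := phiX c tc.
  have d0 : d != 0 by exact: (prime_neq0 hP).
  have nQh : ~ Q h.
    move=> /QP'; rewrite /P' -Eh => /(prime_mul hM (loc_incl hS hP Sd)).
    case; [by apply: Aunit; apply/st; exact: NN_ZZ | by move/(MP _ Sd) | exact: ctM].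
  have : Q (b' * (h * f)).
    have -> : b' * (h * f) = c' * g.
      by apply: phi_inj; rewrite !rmorphM -Eg -Eb -Ec -Eh Ed; exact: cross_mul.
    exact: QM.
  case/Qp; first by move/(Qunit _ _ tb Eb).
  by case/Qp.
apply: (regular_of_principal hS hP dim1 Px0 x00 (a := phi p)) => y; split.
  move=> [a [d [Pa [Sd [Pd ->]]]]].
  have [b [g [tb Eg]]] := clear a (primeW hP Pa).
  have P'g : P' g.
    by rewrite /P' -Eg; apply: (primeMr hM); [exact: PM | apply: Aunit; apply/st; exact: NN_ZZ].
  have [f [q [nf E]]] := Hp g P'g.
  exists (phi q * ((phi f)^-1 * (lX (- b) * d^-1))).
    apply: (subringM hA (Aphi q)); apply: (subringM hA (locM_unit (Aphi f) nf)).
    apply: (subringM hA); last exact: (loc_inv hS Sd Pd).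
    by apply: Aunit; apply: ZZN; apply/st; exact: NN_ZZ.
  have d0 : d != 0 by exact: (prime_neq0 hP).
  have f0 : phi f != 0 by exact: (prime_neq0 hM).
  have b0 := lX_neq0 k b.
  have E2 : phi f * (a * lX b) = phi q * phi p by rewrite Eg -!rmorphM E.
  by rewrite lXN; exact: cross_div.
by move=> [r Ar ->]; exact: (primeMl hM).
Qed.

End Torus.
End Laurent.

(** * The lattice of a mixed graph *)

Section Functionals.
Variable n : nat.
Notation vec := 'rV[int]_n.

Definition dvec (i : 'I_n) : vec := delta_mx ord0 i.
Definition rhov (e : edge n) : vec := \row_i rho e i.
Definition gens (G : {set edge n}) : seq vec := [seq rhov e | e <- enum G].

Lemma mem_gens (G : {set edge n}) e : e \in G -> rhov e \in gens G.
Proof. by move=> eG; apply: map_f; rewrite mem_enum. Qed.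

Lemma gensP (G : {set edge n}) v : v \in gens G -> exists2 e, e \in G & v = rhov e.
Proof. by case/mapP => e; rewrite mem_enum => eG ->; exists e. Qed.

Lemma gens_sub (G H : {set edge n}) : H \subset G -> {subset gens H <= gens G}.
Proof. by move=> HG v /gensP [e /(subsetP HG) eG ->]; exact: mem_gens. Qed.

Lemma rhov_pos i j : rhov (pos_edge i j) = dvec i + dvec j.
Proof. by apply/rowP => l; rewrite !mxE /=; case: eqP; case: eqP. Qed.
Lemma rhov_neg i j : rhov (neg_edge i j) = - (dvec i + dvec j).
Proof. by apply/rowP => l; rewrite !mxE /=; case: eqP; case: eqP. Qed.
Lemma rhov_dir i j : rhov (dir_edge i j) = dvec j - dvec i.
Proof. by apply/rowP => l; rewrite !mxE /=; case: eqP; case: eqP. Qed.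

Section Ev.
Variable K : comNzRingType.
Implicit Types (t : 'I_n -> K) (a b : vec).

(** The target K varies: the integers for supporting functionals, the fields with two and three
    elements for counting. *)
Definition ev t a : K := \sum_i t i * (a ord0 i)%:~R.

Lemma evD t a b : ev t (a + b) = ev t a + ev t b.
Proof. by rewrite -big_split; apply: eq_bigr => i _; rewrite mxE rmorphD mulrDr. Qed.
Lemma ev0 t : ev t 0 = 0.
Proof. by rewrite /ev big1 // => i _; rewrite mxE mulr0. Qed.
Lemma evN t a : ev t (- a) = - ev t a.
Proof. by rewrite -sumrN; apply: eq_bigr => i _; rewrite mxE rmorphN mulrN. Qed.
Lemma evB t a b : ev t (a - b) = ev t a - ev t b.
Proof. by rewrite evD evN. Qed.
Lemma evMn t a m : ev t (a *+ m) = ev t a *+ m.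
Proof. by elim: m => [|m IH]; rewrite ?mulr0n ?ev0 // !mulrS evD IH. Qed.
Lemma evMz t a (m : int) : ev t (a *~ m) = ev t a *~ m.
Proof. by case: m => m; rewrite ?NegzE ?mulrNz -?pmulrn ?evN evMn. Qed.
Lemma evMzr t a (m : int) : ev t (a *~ m) = ev t a * m%:~R.
Proof. by rewrite evMz mulrzr. Qed.
Lemma ev_dvec t i : ev t (dvec i) = t i.
Proof.
rewrite /ev (bigD1 i) //= big1 ?addr0; first by rewrite !mxE !eqxx mulr1.
by move=> j ji; rewrite !mxE (negbTE ji) mulr0.
Qed.
Lemma ev_lin t t' c a : ev (fun i => t i + c * t' i) a = ev t a + c * ev t' a.
Proof. by rewrite mulr_sumr -big_split; apply: eq_bigr => i _ /=; rewrite mulrDl mulrA. Qed.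
Lemma ev_scale t c a : ev (fun i => c * t i) a = c * ev t a.
Proof. by rewrite mulr_sumr; apply: eq_bigr => i _ /=; rewrite mulrA. Qed.
Lemma eq_ev t t' a : t =1 t' -> ev t a = ev t' a.
Proof. by move=> tt'; apply: eq_bigr => i _; rewrite tt'. Qed.

Definition kills t (H : {set edge n}) := forall e, e \in H -> ev t (rhov e) = 0.

Lemma kills_lat t H a : kills t H -> lat (gens H) a -> ev t a = 0.
Proof.
move=> tH; elim=> [|v c /gensP [e eH ->] _ IH|v c /gensP [e eH ->] _ IH].
- exact: ev0.
- by rewrite evD IH tH // addr0.
- by rewrite evB IH tH // subr0.
Qed.
End Ev.

Section Graph.
Variable H : {set edge n}.
Notation E := (aug_edges H).

(* The class of an artificial vertex is chosen so that [vec_of x + vec_of y] lies in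
   the lattice of [H] for every augmented edge [x y]. *)
Definition vec_of (x : avert n) : vec :=
  match x with
  | inl i => dvec i
  | inr (inr (i, j)) => - dvec i
  | inr _ => 0
  end.

Lemma adj_sym x y : adj E x y = adj E y x.
Proof.
by apply/existsP/existsP => -[s]; rewrite orbC => xy; exists s.
Qed.

Lemma adjP x y : adj E x y -> exists s, (s, x, y) \in E \/ (s, y, x) \in E.
Proof. by case/existsP => s /orP [] h; exists s; [left|right]. Qed.

Lemma aug_edgesP a : a \in E -> exists2 e, e \in H & a \in aug_img e.
Proof. by rewrite inE => /exists_inP [e eH ae]; exists e. Qed.

Lemma mem_aug_edges e a : e \in H -> a \in aug_img e -> a \in E.
Proof. by move=> eH ae; rewrite inE; apply/exists_inP; exists e. Qed.

Lemma adj_edge s x y : (s, x, y) \in E -> adj E x y.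
Proof. by move=> xy; apply/existsP; exists s; rewrite xy. Qed.

Lemma edge_verts s x y : (s, x, y) \in E -> (x \in aug_verts H) && (y \in aug_verts H).
Proof.
case/aug_edgesP => -[[[i j]|[i j]]|[i j]] eH; rewrite !inE ?xpair_eqE /=.
- by case/andP => /andP [_ /eqP ->] /eqP ->.
- by case/andP => /andP [_ /eqP ->] /eqP ->.
- by case/orP => /andP [/andP [_ /eqP ->] /eqP ->]; rewrite eH.
Qed.

Lemma adj_verts x y : adj E x y -> (x \in aug_verts H) && (y \in aug_verts H).
Proof. by case/adjP => s [/edge_verts|/edge_verts] //; rewrite andbC. Qed.

Lemma edge_lat s x y : (s, x, y) \in E -> lat (gens H) (vec_of x + vec_of y).
Proof.
case/aug_edgesP => -[[[i j]|[i j]]|[i j]] eH; rewrite !inE ?xpair_eqE /=.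
- case/andP => /andP [_ /eqP ->] /eqP -> /=; rewrite -rhov_pos.
  by apply: lat_mem; exact: mem_gens.
- case/andP => /andP [_ /eqP ->] /eqP -> /=; rewrite -[_ + _]opprK -rhov_neg.
  by apply: ZZN; apply: lat_mem; exact: mem_gens.
- case/orP => /andP [/andP [_ /eqP ->] /eqP ->] /=.
    by rewrite subrr; exact: ZZ0.
  by rewrite addrC -rhov_dir; apply: lat_mem; exact: mem_gens.
Qed.

Lemma adj_lat x y : adj E x y -> lat (gens H) (vec_of x + vec_of y).
Proof. by case/adjP => s [/edge_lat|/edge_lat] //; rewrite addrC. Qed.

(** Each step of the path changes the sign of the class modulo the lattice; the parity of the path
    is forgotten, which leaves two alternatives. *)
Lemma connect_lat x y : connect (adj E) x y ->
  lat (gens H) (vec_of y - vec_of x) \/ lat (gens H) (vec_of y + vec_of x).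
Proof.
case/connectP => p; elim: p x => [|z p IH] x /=.
  by move=> _ ->; left; rewrite subrr; exact: ZZ0.
case/andP => /adj_lat xz zp yl; case: (IH z zp yl) => h; [right|left].
  by have := ZZD h xz; rewrite [vec_of x + _]addrC addrA subrK.
by have := ZZB h xz; rewrite opprD addrACA subrr addr0.
Qed.

Lemma connect_symE : connect_sym (adj E).
Proof. by apply: sym_connect_sym; exact: adj_sym. Qed.

Lemma comp_of_refl x : x \in aug_verts H -> x \in comp_of H x.
Proof. by move=> xH; rewrite inE xH connect0. Qed.

Lemma real_vert i : inl i \in aug_verts H.
Proof. by rewrite inE. Qed.

Lemma comp_of_eq x y : connect (adj E) x y -> comp_of H x = comp_of H y.
Proof.
by move=> xy; apply/setP => z; rewrite !inE (same_connect connect_symE xy).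
Qed.

Lemma mem_comp C x : C \in comps H -> x \in C -> C = comp_of H x.
Proof.
by case/imsetP => y yH ->; rewrite inE => /andP [_ yx]; exact: comp_of_eq.
Qed.

Lemma comp_real_mem i : comp_of H (inl i) \in comps H.
Proof. by apply: imset_f; exact: real_vert. Qed.

Lemma comp_connect C x y : C \in comps H -> x \in C -> y \in C -> connect (adj E) x y.
Proof. by move=> CH xC; rewrite (mem_comp CH xC) inE => /andP []. Qed.

Lemma comp_adj C x y : C \in comps H -> adj E x y -> (x \in C) = (y \in C).
Proof.
move=> CH xy; have /andP [xH yH] := adj_verts xy.
by apply/idP/idP => h; rewrite (mem_comp CH h) inE ?xH ?yH connect1 // adj_sym.
Qed.

Lemma vert_real x : x \in aug_verts H -> exists i, connect (adj E) x (inl i).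
Proof.
case: x => [i|e]; first by exists i; exact: connect0.
rewrite inE => /andP [eH]; case: e eH => [//|[i j]] eH _; exists i.
apply: connect1; rewrite adj_sym; apply: (adj_edge (s := false)).
by apply: (mem_aug_edges eH); rewrite !inE eqxx.
Qed.

Lemma comp_real C : C \in comps H -> exists i, inl i \in C.
Proof.
case/imsetP => x xH ->; have [i xi] := vert_real xH.
by exists i; rewrite inE real_vert.
Qed.

Section KillsVert.
Variable K : comNzRingType.

(** The sign of an edge only multiplies rho by -1, so one rule covers both signs; for a directed
    edge the artificial vertex forces equal values at the two ends. *)
Lemma kills_of_vert (T : avert n -> K) :
  (forall x y, adj E x y -> T x + T y = 0) -> kills (fun i => T (inl i)) H.
Proof.
move=> TH e eH; case: e eH => [[[i j]|[i j]]|[i j]] eH.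
- rewrite rhov_pos evD !ev_dvec; apply: TH; apply: (adj_edge (s := true)).
  by apply: (mem_aug_edges eH); rewrite inE.
- rewrite rhov_neg evN evD !ev_dvec TH ?oppr0 //; apply: (adj_edge (s := false)).
  by apply: (mem_aug_edges eH); rewrite inE.
- rewrite rhov_dir evB !ev_dvec.
  have h1 : T (inl i) + T (inr (dir_edge i j)) = 0.
    by apply: TH; apply: (adj_edge (s := false)); apply: (mem_aug_edges eH); rewrite !inE eqxx.
  have h2 : T (inr (dir_edge i j)) + T (inl j) = 0.
    by apply: TH; apply: (adj_edge (s := true)); apply: (mem_aug_edges eH); rewrite !inE eqxx orbT.
  by rewrite -[T (inl j)](addKr (T (inr (dir_edge i j)))) h2 addr0 -opprD addrC h1 oppr0.
Qed.

Lemma kills_connect (t : 'I_n -> K) x y : kills t H -> connect (adj E) x y ->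
  ev t (vec_of y) = ev t (vec_of x) \/ ev t (vec_of y) = - ev t (vec_of x).
Proof.
move=> tH /connect_lat [] /(kills_lat tH); rewrite ?evB ?evD => /eqP.
  by rewrite subr_eq0 => /eqP; left.
by rewrite addr_eq0 => /eqP; right.
Qed.

End KillsVert.

(** The functional sigma on all augmented vertices: the artificial ones are included so that its
    vanishing on H can be checked edge by edge in the augmented graph. *)
Definition sgnf (C L : {set avert n}) (x : avert n) : int :=
  if x \in C then (if x \in L then 1 else -1) else 0.
Definition sgn (C L : {set avert n}) (i : 'I_n) : int := sgnf C L (inl i).

Lemma sgnf_adj (C L : {set avert n}) x y : C \in comps H -> is_bipartition E C L -> adj E x y ->
  sgnf C L x + sgnf C L y = 0.
Proof.
move=> CH /andP [LC /forallP bip] xy; rewrite /sgnf -(comp_adj CH xy).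
case: ifP => xC //.
have yC : y \in C by rewrite -(comp_adj CH xy).
have : (x \in L) != (y \in L).
  case/adjP: xy => s [] h; have := bip (s, x, y); have := bip (s, y, x);
    rewrite h /= ?xC ?yC ?orbT //=.
  by rewrite eq_sym.
by case: (x \in L); case: (y \in L).
Qed.

Lemma sgn_kills C L : C \in comps H -> is_bipartition E C L -> kills (sgn C L) H.
Proof. by move=> CH bip; apply: kills_of_vert => x y; exact: sgnf_adj. Qed.

Lemma sgn_sqr (C L : {set avert n}) i : inl i \in C -> sgn C L i * sgn C L i = 1.
Proof. by rewrite /sgn /sgnf => ->; case: ifP. Qed.

Lemma ind_kills (C : {set avert n}) (K : comNzRingType) : C \in comps H -> 2%:R = 0 :> K ->
  kills (fun i => (inl i \in C)%:R : K) H.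
Proof.
move=> CH K2; apply: (kills_of_vert (T := fun x => (x \in C)%:R : K)) => x y xy.
by rewrite -(comp_adj CH xy); case: (x \in C); rewrite ?addr0 // -mulr2n.
Qed.

(** If [dvec i *+ 2] were outside the lattice, no vertex of C could be congruent both to [dvec i]
    and to its negative. Every vertex is congruent to one of them, and the two classes would form a
    bipartition. *)
Lemma nonbip_double (C : {set avert n}) i : C \in comps H -> ~~ bipartite E C -> inl i \in C ->
  lat (gens H) (dvec i *+ 2).
Proof.
move=> CH nb iC; apply: contrapT => n2; case/negP: nb; apply/existsP.
exists [set y in C | `[< lat (gens H) (vec_of y - dvec i) >]].
apply/andP; split; first by apply/subsetP => y; rewrite inE => /andP [].
apply/forallP => -[[s x] y]; apply/implyP => a; apply/implyP => xyC.
have xy := adj_edge a; have xCy := comp_adj CH xy.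
have [xC yC] : x \in C /\ y \in C by move: xyC; rewrite -xCy orbb.
have dich z : z \in C -> (lat (gens H) (vec_of z - dvec i) /\ ~ lat (gens H) (vec_of z + dvec i))
    \/ (~ lat (gens H) (vec_of z - dvec i) /\ lat (gens H) (vec_of z + dvec i)).
  move=> zC; have excl : lat (gens H) (vec_of z - dvec i) ->
      lat (gens H) (vec_of z + dvec i) -> False.
    move=> h1 h2; apply: n2; have := ZZB h2 h1.
    by rewrite opprB addrC addrA subrK mulr2n.
  by case: (connect_lat (comp_connect CH iC zC)) => h; [left|right]; split=> // h';
    [exact: excl h' | exact: excl h].
have lxy := adj_lat xy; rewrite !inE xC yC /=; apply/eqP => exy.
have {}exy : lat (gens H) (vec_of x - dvec i) <-> lat (gens H) (vec_of y - dvec i).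
  by rewrite -(asboolE (lat (gens H) (vec_of x - _))) exy asboolE.
case: (dich x xC) (dich y yC) => -[h1 h2] [] [h3 h4]; try tauto.
- apply: h4; have := ZZB lxy h1; congr (lat _ _).
  by rewrite opprB addrC addrA subrK addrC.
- apply: h3; have := ZZB lxy h2; congr (lat _ _).
  by rewrite opprD addrACA subrr add0r.
Qed.

Lemma comp_combination C i0 (v : vec) : C \in comps H -> inl i0 \in C ->
  forall eps : 'I_n -> int,
  (forall i, inl i \in C -> lat (gens H) (dvec i - dvec i0 *~ eps i)) ->
  lat (gens H) (dvec i0 *~ (\sum_(i | inl i \in C) v ord0 i * eps i)) ->
  lat (gens H) (\sum_(i | inl i \in C) dvec i *~ v ord0 i).
Proof.
move=> CH i0C eps he hs.
have -> : \sum_(i | inl i \in C) dvec i *~ v ord0 i =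
    \sum_(i | inl i \in C) (dvec i - dvec i0 *~ eps i) *~ v ord0 i +
    dvec i0 *~ (\sum_(i | inl i \in C) v ord0 i * eps i).
  rewrite mulrz_sumr -big_split; apply: eq_bigr => i _ /=.
  by rewrite mulrzBl -mulrzA [eps i * _]mulrC subrK.
by apply: ZZD => //; apply: ZZ_sum => i iC; apply: ZZMz; exact: he.
Qed.

(** On a component all unit vectors agree up to sign modulo the lattice, so v reduces there to a
    multiple of one of them. On a bipartite component the multiplier is, up to sign, the value of
    sigma, hence 0; on any other it matters only modulo 2, by [nonbip_double]. *)
Lemma lat_dual (v : vec) :
  (forall C L, C \in comps H -> is_bipartition E C L -> ev (sgn C L) v = 0) ->
  (forall C, C \in comps H -> (2 %| \sum_(i | inl i \in C) v ord0 i)%Z) ->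
  lat (gens H) v.
Proof.
move=> hbip heven.
have -> : v = \sum_i dvec i *~ v ord0 i.
  by rewrite {1}[v]row_sum_delta; apply: eq_bigr => i _; rewrite -[X in X *: _]intz scaler_int.
rewrite (partition_big (fun i => comp_of H (inl i)) (mem (comps H))) /=; last first.
  by move=> i _; exact: comp_real_mem.
apply: ZZ_sum => C CH.
rewrite (eq_bigl (fun i => inl i \in C)); last first.
  move=> i; apply/eqP/idP => [<-|/(mem_comp CH) //].
  by apply: comp_of_refl; exact: real_vert.
have [i0 i0C] := comp_real CH.
have conn i : inl i \in C -> lat (gens H) (dvec i - dvec i0) \/ lat (gens H) (dvec i + dvec i0).
  by move=> iC; exact: (connect_lat (comp_connect CH i0C iC)).
have [/existsP [L bip]|nb] := boolP (bipartite E C).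
- have f0 := sgn_kills CH bip; have sq0 := sgn_sqr L i0C.
  apply: (comp_combination CH i0C (eps := fun i => sgn C L i * sgn C L i0)).
    move=> i iC; have sq := sgn_sqr L iC.
    case: (conn i iC) => h; have := kills_lat f0 h; rewrite ?evB ?evD !ev_dvec => /eqP.
      by rewrite subr_eq0 => /eqP ->; rewrite sq0 mulr1z.
    by rewrite addr_eq0 => /eqP ->; rewrite mulNr sq0 mulrNz mulr1z opprK.
  rewrite (_ : \sum_(i | _) _ = ev (sgn C L) v * sgn C L i0).
    by rewrite hbip // mul0r mulr0z; exact: ZZ0.
  rewrite /ev mulr_suml [RHS](bigID (fun i => inl i \in C)) /= [X in _ + X]big1 ?addr0.
    by apply: eq_bigr => i _; rewrite intz mulrA [v _ _ * _]mulrC.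
  by move=> i niC; rewrite /sgn /sgnf (negbTE niC) !mul0r.
- have d0 := nonbip_double CH nb i0C.
  apply: (comp_combination CH i0C (eps := fun=> 1)).
    move=> i iC; rewrite mulr1z; case: (conn i iC) => // h.
    by have := ZZB h d0; rewrite mulr2n opprD addrA addrK.
  rewrite (eq_bigr (fun i => v ord0 i)); last by move=> i _; rewrite mulr1.
  have /dvdzP [q ->] := heven C CH.
  by rewrite mulrC mulrzA; apply: ZZMz.
Qed.

(** Doubling makes the parity condition automatic. The factors 2 in the later lattice relations come
    from here. *)
Lemma lat_dual2 (v : vec) :
  (forall C L, C \in comps H -> is_bipartition E C L -> ev (sgn C L) v = 0) ->
  lat (gens H) (v *+ 2).
Proof.
move=> h; apply: lat_dual => [C L CH bip|C CH]; first by rewrite evMn h // mul0rn.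
rewrite (eq_bigr (fun i => v ord0 i * 2)); last by move=> i _; rewrite mulmxnE mulr_natr.
by rewrite -mulr_suml dvdz_mull.
Qed.

End Graph.
End Functionals.

(** * Counting functionals over finite fields *)

Section Counting.
Variable n : nat.
Notation vec := 'rV[int]_n.

Definition ker_set (K : finFieldType) (H : {set edge n}) : {set {ffun 'I_n -> K}} :=
  [set t : {ffun 'I_n -> K} | [forall e in H, ev t (rhov e) == 0]].

Lemma ker_setP (K : finFieldType) (H : {set edge n}) (t : {ffun 'I_n -> K}) :
  reflect (kills t H) (t \in ker_set K H).
Proof.
rewrite inE; apply: (iffP forall_inP) => h e eH; first by apply/eqP/h.
by rewrite h.
Qed.

(** D selects the components that carry a nonzero functional. There f is a reference without zeros,
    and any other functional is determined by one scalar, its ratio to f; [pffun_on 0] collects the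
    families of scalars supported on D. *)
Lemma card_ker_set (K : finFieldType) (H : {set edge n}) (D : {set {set avert n}})
    (f : avert n -> K) :
  D \subset comps H ->
  (forall C, C \in D -> forall x, x \in C -> f x != 0) ->
  (forall x y, adj (aug_edges H) x y -> comp_of H x \in D -> f x + f y = 0) ->
  (forall t, kills t H -> forall i, comp_of H (inl i) \notin D -> t i = 0 :> K) ->
  #|ker_set K H| = (#|K| ^ #|D|)%N.
Proof.
move=> DH f0 fadj tD.
pose Psi (phi : {ffun {set avert n} -> K}) : {ffun 'I_n -> K} :=
  [ffun i => phi (comp_of H (inl i)) * f (inl i)].
rewrite -(card_pffun_on (0 : K) (mem D) K).
have -> : ker_set K H = Psi @: pffun_on 0 (mem D) K.
  apply/setP => t; apply/ker_setP/imsetP.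
    move=> tH; pose phi : {ffun {set avert n} -> K} := [ffun C : {set avert n} =>
      if C \in D then (if [pick i | inl i \in C] is Some i then t i / f (inl i) else 0) else 0].
    exists phi.
      apply/pffun_onP; split=> //.
      by apply/subsetP => C; rewrite inE ffunE; case: ifP => //; rewrite eqxx.
    apply/ffunP => i; rewrite !ffunE; case: ifPn => [CD|/(tD _ tH) ->]; last by rewrite mul0r.
    case: pickP => [j jC|/(_ i)]; last by rewrite comp_of_refl ?real_vert.
    (* The reference cut down to D also kills H, so t and g change by the same sign from i to the
       chosen j and their ratio is the same at both. *)
    pose g x := if comp_of H x \in D then f x else 0.
    have gH : kills (fun i => g (inl i)) H.
      apply: (kills_of_vert (T := g)) => x y xy; rewrite /g.
      rewrite -(comp_of_eq (connect1 xy)); case: ifP; rewrite ?addr0 //; exact: fadj.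
    have ij : connect (adj (aug_edges H)) (inl i) (inl j) by move: jC; rewrite inE => /andP [].
    have gi : g (inl i) = f (inl i) by rewrite /g CD.
    have gj : g (inl j) = f (inl j) by rewrite /g -(comp_of_eq ij) CD.
    have fj0 : f (inl j) != 0 by exact: f0 jC.
    case/connect_lat: ij => /= h; have := kills_lat gH h; have := kills_lat tH h;
      rewrite ?evB ?evD !ev_dvec gi gj => /eqP.
      rewrite subr_eq0 => /eqP tij /eqP; rewrite subr_eq0 => /eqP fij.
      by rewrite -fij -tij divfK.
    rewrite addr_eq0 => /eqP tij /eqP; rewrite addr_eq0 => /eqP fij.
    by rewrite -[f (inl i)]opprK -fij mulrN divfK // tij opprK.
  case=> phi /pffun_onP [/subsetP phiD _] ->.
  pose T x := phi (comp_of H x) * f x.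
  have TH : kills (fun i => T (inl i)) H.
    apply: kills_of_vert => x y xy; rewrite /T -(comp_of_eq (connect1 xy)) -mulrDr.
    have [CD|nCD] := boolP (comp_of H x \in D); first by rewrite fadj // mulr0.
    have -> : phi (comp_of H x) = 0; last by rewrite mul0r.
    by apply/eqP; apply: contraR nCD => /phiD.
  by move=> e eH; rewrite -[RHS](TH e eH); apply: eq_ev => i; rewrite ffunE.
rewrite card_in_imset // => phi phi' /pffun_onP [/subsetP phiD _] /pffun_onP [/subsetP phiD' _] e.
apply/ffunP => C; have [CD|nCD] := boolP (C \in D).
  have CH := subsetP DH C CD; have [i iC] := comp_real CH.
  have := congr1 (fun t : {ffun 'I_n -> K} => t i) e; rewrite !ffunE -(mem_comp CH iC).
  by move/(mulIf (f0 C CD _ iC)).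
have z (psi : {ffun {set avert n} -> K}) :
    (forall C, C \in (fun C => psi C != 0) -> C \in D) -> psi C = 0.
  by move=> h; apply/eqP; apply: contraR nCD => /h.
by rewrite (z _ phiD) (z _ phiD').
Qed.

(** In characteristic 2 the constant 1 is a reference on every component, bipartite or not. *)
Lemma card_ker_F2 (H : {set edge n}) : #|ker_set 'F_2 H| = (2 ^ ncomp H)%N.
Proof.
rewrite (card_ker_set (D := comps H) (f := fun=> 1)) ?card_Fp //.
- by move=> x y _ _; apply/eqP.
- by move=> t _ i; rewrite comp_real_mem.
Qed.

(* Only the characteristic matters: it must not be 2, so that a functional vanishes
   on the components that are not bipartite. *)
Lemma card_ker_F3 (H : {set edge n}) : #|ker_set 'F_3 H| = (3 ^ nbicomp H)%N.
Proof.
pose L C : {set avert n} :=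
  if [pick L | is_bipartition (aug_edges H) C L] is Some L then L else set0.
have Lbip C : bipartite (aug_edges H) C -> is_bipartition (aug_edges H) C (L C).
  by case/existsP => L0 bL0; rewrite /L; case: pickP => // /(_ L0); rewrite bL0.
rewrite (card_ker_set (D := [set C in comps H | bipartite (aug_edges H) C])
  (f := fun x => (sgnf (comp_of H x) (L (comp_of H x)) x)%:~R)) ?card_Fp //.
- by apply/subsetP => C; rewrite inE => /andP [].
- move=> C; rewrite inE => /andP [CH _] x xC; rewrite -(mem_comp CH xC) /sgnf xC.
  by case: ifP.
- move=> x y xy; rewrite inE => /andP [CH /Lbip bip].
  by rewrite -(comp_of_eq (connect1 xy)) -rmorphD /= (sgnf_adj CH bip xy).
- move=> t tH i; rewrite inE comp_real_mem /= => nb.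
  have := nonbip_double (comp_real_mem H i) nb (comp_of_refl (real_vert H i)).
  move=> /(kills_lat tH); rewrite evMn ev_dvec -mulr_natr => /eqP.
  by rewrite mulf_eq0 => /orP [/eqP|].
Qed.

Lemma ev_F2 (C : {set avert n}) (v : vec) :
  (ev (fun i => (inl i \in C)%:R : 'F_2) v == 0) = (2 %| \sum_(i | inl i \in C) v ord0 i)%Z.
Proof.
rewrite (dvdz_pcharf (pchar_Fp (isT : prime 2))) rmorph_sum /= [X in _ = (X == 0)]big_mkcond.
by congr (_ == _); apply: eq_bigr => i _; case: ifP; rewrite ?mul1r ?mul0r.
Qed.

Lemma F2_two : 2%:R = 0 :> 'F_2. Proof. exact/eqP. Qed.

Lemma lat_dual_F2 (H : {set edge n}) (v : vec) :
  (forall C L, C \in comps H -> is_bipartition (aug_edges H) C L -> ev (sgn C L) v = 0) ->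
  (forall t : {ffun 'I_n -> 'F_2}, kills t H -> ev t v = 0) ->
  lat (gens H) v.
Proof.
move=> hbip hF2; apply: lat_dual => // C CH; rewrite -ev_F2; apply/eqP.
rewrite -(hF2 [ffun i => (inl i \in C)%:R]); first by apply: eq_ev => i; rewrite ffunE.
move=> e eH; rewrite -[RHS](ind_kills CH F2_two eH).
by apply: eq_ev => i; rewrite ffunE.
Qed.

Definition avoids (C : {set avert n}) (e : edge n) : bool :=
  match e with
  | inl (inl (i, j)) => (inl i \notin C) && (inl j \notin C)
  | inl (inr (i, j)) => (inl i \notin C) && (inl j \notin C)
  | inr (i, j) => (inl i \notin C) && (inl j \notin C)
  end.

Lemma aug_edges_sub (G H : {set edge n}) : H \subset G -> aug_edges H \subset aug_edges G.
Proof.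
move=> HG; apply/subsetP => a /aug_edgesP [e /(subsetP HG) eG ae]; exact: mem_aug_edges eG ae.
Qed.

Lemma aug_verts_sub (G H : {set edge n}) : H \subset G -> aug_verts H \subset aug_verts G.
Proof.
by move=> HG; apply/subsetP => -[i|e]; rewrite !inE // => /andP [/(subsetP HG) ->].
Qed.

(** If no edge of G outside H touches C, adjacency in G and in H agree there, so C is also closed in
    G. *)
Lemma is_comp_of_out (G H : {set edge n}) C : H \subset G -> C \in comps H ->
  (forall e, e \in G :\: H -> avoids C e) -> is_comp_of G H C.
Proof.
move=> HG CH out.
have inH s x y : (s, x, y) \in aug_edges G -> (x \in C) || (y \in C) -> (s, x, y) \in aug_edges H.
  move=> /aug_edgesP [e eG ae] xyC; have [eH|neH] := boolP (e \in H).
    exact: mem_aug_edges eH ae.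
  have := out e; rewrite inE neH eG => /(_ isT).
  have CsubH z : z \in C -> z \in aug_verts H.
    by move=> zC; move: (zC); rewrite {1}(mem_comp CH zC) inE => /andP [].
  case: e eG ae neH => [[[i j]|[i j]]|[i j]] eG; rewrite !inE ?xpair_eqE /= => ae neH.
  - by move: xyC; case/andP: ae => /andP [_ /eqP ->] /eqP -> h /andP [ni nj]; move: h; rewrite (negbTE ni) (negbTE nj).
  - by move: xyC; case/andP: ae => /andP [_ /eqP ->] /eqP -> h /andP [ni nj]; move: h; rewrite (negbTE ni) (negbTE nj).
  (* The artificial vertex of an edge outside H is not a vertex of the augmented H, so C cannot
     contain it. *)
  - have nt : inr (inr (i, j)) \notin C.
      by apply/negP => /CsubH; rewrite inE (negbTE neH).
    move: xyC; case/orP: ae => /andP [/andP [_ /eqP ->] /eqP ->] h /andP [ni nj]; move: h;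
      by rewrite ?(negbTE ni) ?(negbTE nj) (negbTE nt).
have adjH x y : adj (aug_edges G) x y -> (x \in C) || (y \in C) -> adj (aug_edges H) x y.
  case/adjP => s [] /inH h xyC; first by apply: (adj_edge (s := s)); exact: h.
  by rewrite adj_sym; apply: (adj_edge (s := s)); apply: h; rewrite orbC.
have clC : closed (adj (aug_edges G)) (mem C).
  move=> x y xy; apply/idP/idP => h; [rewrite -(comp_adj CH (adjH x y xy _)) ?h //|].
  by rewrite (comp_adj CH (adjH x y xy _)) ?h ?orbT.
apply/andP; split.
  case/imsetP: (CH) => x xH Cx; apply/imsetP; exists x; first exact: (subsetP (aug_verts_sub HG)).
  apply/setP => y; apply/idP/idP => [yC|].
    move: (yC); rewrite {1}Cx !inE => /andP [yH xy]; apply/andP; split.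
      by move: yH; have /subsetP := aug_verts_sub HG; move=> /(_ y); rewrite !inE.
    apply: connect_sub xy => u v uv; apply: connect1.
    case/existsP: uv => s uv; apply/existsP; exists s.
    by case/orP: uv => /(subsetP (aug_edges_sub HG)) ->; rewrite ?orbT.
  rewrite inE => /andP [_ xy]; have := closed_connect clC xy.
  by rewrite Cx (comp_of_refl xH) -Cx => <-.
apply/eqP/setP => -[[s x] y]; apply/idP/idP; rewrite !inE /= => /andP [aE /andP [xC yC]].
  rewrite xC yC !andbT; have := inH s x y; rewrite !inE; apply; rewrite ?xC //.
rewrite xC yC !andbT; have /subsetP/(_ (s, x, y)) := aug_edges_sub HG.
by rewrite !inE; apply.
Qed.

Lemma is_comp_of_kills (G H : {set edge n}) C L : C \in comps H -> is_comp_of G H C ->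
  is_bipartition (aug_edges H) C L -> kills (sgn C L) G.
Proof.
move=> CH /andP [CG /eqP EE] bip; apply: kills_of_vert => x y xy.
have xyC := comp_adj CG xy.
have [xC|xC] := boolP (x \in C); last by rewrite /sgnf -xyC (negbTE xC).
apply: (sgnf_adj CH bip).
have yC : y \in C by rewrite -xyC.
case/adjP: xy => s [] a.
  have : (s, x, y) \in edges_in (aug_edges G) C by rewrite inE a xC yC.
  by rewrite EE inE => /andP [+ _]; exact: adj_edge.
have : (s, y, x) \in edges_in (aug_edges G) C by rewrite inE a xC yC.
by rewrite EE inE adj_sym => /andP [+ _]; exact: adj_edge.
Qed.

End Counting.

(** * Facet subgraphs and supporting functionals *)

Section Facet.
Variable n : nat.
Notation vec := 'rV[int]_n.
Implicit Types (C L : {set avert n}) (G H : {set edge n}).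

Definition rho_of (K : comNzRingType) (t : 'I_n -> K) (e : edge n) : K :=
  match e with
  | inl (inl (i, j)) => t i + t j
  | inl (inr (i, j)) => - (t i + t j)
  | inr (i, j) => t j - t i
  end.

Lemma ev_rhov (K : comNzRingType) (t : 'I_n -> K) e : ev t (rhov e) = rho_of t e.
Proof.
case: e => [[[i j]|[i j]]|[i j]] /=.
- by rewrite rhov_pos evD !ev_dvec.
- by rewrite rhov_neg evN evD !ev_dvec.
- by rewrite rhov_dir evB !ev_dvec.
Qed.

Lemma sgn_spec C L i : [\/ sgn C L i = 1 /\ inl i \in C, sgn C L i = -1 /\ inl i \in C |
  sgn C L i = 0 /\ inl i \notin C].
Proof.
rewrite /sgn /sgnf; case: ifP => iC; last by apply: Or33.
by case: ifP => _; [apply: Or31 | apply: Or32].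
Qed.

(** An endpoint is in L, in C but not in L, or outside C; the nine combinations are checked for each
    kind of edge. From here on the second facet condition is read as positivity of sigma. *)
Lemma good_edgeP C L e : L \subset C ->
  good_edge (proj_orig L) (proj_orig (C :\: L)) e = (0 < ev (sgn C L) (rhov e)).
Proof.
move=> /subsetP LC; rewrite ev_rhov.
have H i : (inl i \in C, inl i \in L, sgn C L i) \in
    [:: (true, true, 1); (true, false, -1); (false, false, 0)].
  rewrite /sgn /sgnf; have := LC (inl i).
  case: (inl i \in L) => [/(_ isT) ->|_]; first by rewrite !inE eqxx.
  by case: (inl i \in C); rewrite !inE !eqxx ?orbT.
by case: e => [[[i j]|[i j]]|[i j]] /=; rewrite !inE; move: (H i) (H j); rewrite !inE !xpair_eqE;
  do 2 (case/or3P => /andP [/andP [/eqP -> /eqP ->] /eqP ->]).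
Qed.

Lemma ev_sgn_bound C L e : 0 < ev (sgn C L) (rhov e) ->
  ev (sgn C L) (rhov e) = 1 \/ ev (sgn C L) (rhov e) = 2.
Proof.
rewrite ev_rhov; case: e => [[[i j]|[i j]]|[i j]] /=;
  case: (sgn_spec C L i) => -[-> _]; case: (sgn_spec C L j) => -[-> _]; lia.
Qed.

(** Value 2 needs both endpoints in C, and then the edge could not have positive value on the
    disjoint component C'. *)
Lemma ev_sgn_disjoint H C L C' L' e : C \in comps H -> C' \in comps H -> C != C' ->
  0 < ev (sgn C L) (rhov e) -> 0 < ev (sgn C' L') (rhov e) -> ev (sgn C L) (rhov e) = 1.
Proof.
move=> CH CH' CC'; rewrite !ev_rhov.
have dis i : inl i \in C -> inl i \in C' -> False.
  by move=> /(mem_comp CH) eC /(mem_comp CH') eC'; case/eqP: CC'; rewrite eC -eC'.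
case: e => [[[i j]|[i j]]|[i j]] /=;
  case: (sgn_spec C L i) => -[-> iC]; case: (sgn_spec C' L' i) => -[-> iC'];
  try (by case: (dis _ iC iC'));
  case: (sgn_spec C L j) => -[-> jC]; case: (sgn_spec C' L' j) => -[-> jC'];
  try (by case: (dis _ jC jC')); lia.
Qed.

Lemma kills_F2_const H C (t : 'I_n -> 'F_2) i j : C \in comps H -> kills t H ->
  inl i \in C -> inl j \in C -> t i = t j.
Proof.
move=> CH tH iC jC; case: (kills_connect tH (comp_connect CH jC iC)); rewrite !ev_dvec => //.
by move=> ->; apply: oppr_pchar2; apply: pchar_Fp.
Qed.

(** Value 2 needs both endpoints in C, where an F_2 functional that kills H is constant; the two
    contributions cancel. *)
Lemma ev_sgn_two H C L e (t : 'I_n -> 'F_2) : C \in comps H -> kills t H ->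
  ev (sgn C L) (rhov e) = 2 -> ev t (rhov e) = 0.
Proof.
move=> CH tH; rewrite !ev_rhov.
have F2 (x : 'F_2) : x + x = 0 by rewrite -mulr2n -mulr_natr F2_two mulr0.
case: e => [[[i j]|[i j]]|[i j]] /=;
  case: (sgn_spec C L i) => -[-> iC]; case: (sgn_spec C L j) => -[-> jC] //;
  move=> _; rewrite (kills_F2_const CH tH iC jC) ?F2 ?oppr0 ?subrr //.
Qed.

(** A connected bipartite graph has only two bipartitions, exchanged by a sign; c is that sign. *)
Lemma sgn_ratio H C L L' : C \in comps H -> is_bipartition (aug_edges H) C L ->
  is_bipartition (aug_edges H) C L' ->
  exists2 c : int, c * c = 1 & forall i, sgn C L i = c * sgn C L' i.
Proof.
move=> CH bip bip'; have [i0 i0C] := comp_real CH.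
have s0 := sgn_sqr L i0C; have s0' := sgn_sqr L' i0C.
exists (sgn C L i0 * sgn C L' i0); first by rewrite mulrACA s0 s0'.
move=> i; have [iC|niC] := boolP (inl i \in C); last by rewrite /sgn /sgnf (negbTE niC) mulr0.
have := connect_lat (comp_connect CH i0C iC) => /= -[] h;
  have := kills_lat (sgn_kills CH bip) h; have := kills_lat (sgn_kills CH bip') h;
  rewrite ?evB ?evD !ev_dvec => /eqP.
  rewrite subr_eq0 => /eqP -> /eqP; rewrite subr_eq0 => /eqP ->.
  by rewrite -mulrA s0' mulr1.
rewrite addr_eq0 => /eqP -> /eqP; rewrite addr_eq0 => /eqP ->.
by rewrite mulrN -mulrA s0' mulr1.
Qed.

(** Codimension at most one without ranks: on the edges of G every functional of a bipartite
    component of H is a multiple of s. Cross multiplication admits values that are 0. *)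
Definition proportional_kills G H (s : 'I_n -> int) : Prop :=
  forall C L, C \in comps H -> is_bipartition (aug_edges H) C L ->
  forall e e', e \in G -> e' \in G ->
    ev (sgn C L) (rhov e) * ev s (rhov e') = ev s (rhov e) * ev (sgn C L) (rhov e').

Lemma ker_set_sub G H (K : finFieldType) : H \subset G -> ker_set K G \subset ker_set K H.
Proof.
move=> HG; apply/subsetP => t /ker_setP tG; apply/ker_setP => e eH.
by apply: tG; exact: (subsetP HG).
Qed.

(** A new bipartite component exists, since otherwise every F_3 functional killing H would kill G,
    against the counts. Two distinct new components are both positive outside H, so by
    [ev_sgn_disjoint] both take the value 1 there and they agree on G. *)
Lemma facet_functional G H : facet_subgraph G H ->
  exists C L, [/\ C \in comps H, is_bipartition (aug_edges H) C L,
    forall e, e \in G :\: H -> 0 < ev (sgn C L) (rhov e) &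
    proportional_kills G H (sgn C L)].
Proof.
case/andP => /andP [HG /eqP nb] /forall_inP facet.
have pos C : C \in comps H -> bipartite (aug_edges H) C -> ~~ is_comp_of G H C ->
    exists2 L, is_bipartition (aug_edges H) C L &
      forall e, e \in G :\: H -> 0 < ev (sgn C L) (rhov e).
  move=> CH bip nC; have := facet C CH; rewrite bip nC => /existsP [L /andP [bL /forall_inP good]].
  exists L => // e eGH; rewrite -good_edgeP; first exact: good.
  by case/andP: bL.
have [C [CH bip nC]] : exists C, [/\ C \in comps H, bipartite (aug_edges H) C & ~~ is_comp_of G H C].
  apply: contrapT => noC.
  suff : ker_set 'F_3 H \subset ker_set 'F_3 G.
    by move/subset_leq_card; rewrite !card_ker_F3 nb leq_exp2l // ltnn.
  apply/subsetP => t /ker_setP tH; apply/ker_setP => e eG.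
  have /(kills_lat tH) : lat (gens H) (rhov e *+ 2).
    apply: lat_dual2 => C L CH bL; apply: (is_comp_of_kills CH _ bL eG).
    apply: contrapT => /negP nC; apply: noC; exists C; split=> //; apply/existsP; by exists L.
  by rewrite evMn -mulr_natr => /eqP; rewrite mulf_eq0 => /orP [/eqP|].
have [L bL posL] := pos C CH bip nC; exists C, L; split=> // C' L' CH' bL' e e' eG eG'.
have [isC|nC'] := boolP (is_comp_of G H C').
  by rewrite !(is_comp_of_kills CH' isC bL') // mul0r mulr0.
have [L2 bL2 posL2] : exists2 L2, is_bipartition (aug_edges H) C' L2 &
      forall e, e \in G :\: H -> 0 < ev (sgn C' L2) (rhov e).
  by apply: pos => //; apply/existsP; exists L'.
have [c _ cE] := sgn_ratio CH' bL' bL2.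
rewrite !(eq_ev _ cE) !ev_scale.
suff E : ev (sgn C' L2) (rhov e) * ev (sgn C L) (rhov e') =
  ev (sgn C L) (rhov e) * ev (sgn C' L2) (rhov e') by rewrite -mulrA E mulrCA.
have [CC'|CC'] := eqVneq C C'.
  move: bL2; rewrite -CC' => bL2; have [d _ dE] := sgn_ratio CH bL2 bL.
  by rewrite !(eq_ev _ dE) !ev_scale -mulrA mulrCA.
suff eqv f : f \in G -> ev (sgn C' L2) (rhov f) = ev (sgn C L) (rhov f) by rewrite !eqv // mulrC.
move=> fG; have [fH|nfH] := boolP (f \in H).
  by rewrite (sgn_kills CH bL fH) (sgn_kills CH' bL2 fH).
have fGH : f \in G :\: H by rewrite inE nfH.
rewrite (ev_sgn_disjoint CH CH' CC' (posL _ fGH) (posL2 _ fGH)).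
by rewrite eq_sym in CC'; exact: (ev_sgn_disjoint CH' CH CC' (posL2 _ fGH) (posL _ fGH)).
Qed.

Lemma facet_proper G H : facet_subgraph G H -> exists e, e \in G :\: H.
Proof.
case/andP => /andP [HG /eqP nb] _; apply/set0Pn; apply: contra_eqN nb => /eqP GH0.
have -> : G = H by apply/eqP; rewrite eqEsubset HG andbT -setD_eq0 GH0.
by rewrite eqn_leq ltnn andbF.
Qed.

Section CompCount.
Variables (G H : {set edge n}) (C L : {set avert n}).
Hypotheses (HG : H \subset G) (CH : C \in comps H).
Hypothesis bL : is_bipartition (aug_edges H) C L.
Hypothesis pos : forall e, e \in G :\: H -> 0 < ev (sgn C L) (rhov e).
Hypothesis prop : proportional_kills G H (sgn C L).
Notation s := (sgn C L).

Let ind : {ffun 'I_n -> 'F_2} := [ffun i => (inl i \in C)%:R].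

Let ind_kill : kills ind H.
Proof.
move=> e eH; rewrite -[RHS](ind_kills CH F2_two eH).
by apply: eq_ev => i; rewrite ffunE.
Qed.

Let ev_ind e : ev s (rhov e) = 1 -> ev ind (rhov e) = 1.
Proof.
rewrite !ev_rhov; case: e => [[[i j]|[i j]]|[i j]] /=; rewrite !ffunE;
  case: (sgn_spec C L i) => -[-> iC]; case: (sgn_spec C L j) => -[-> jC] //;
  by rewrite ?iC ?jC ?(negbTE iC) ?(negbTE jC) //; move=> _; apply/eqP.
Qed.

Let inG e : e \in G :\: H -> e \in G. Proof. by rewrite inE => /andP []. Qed.

Lemma prop_lat e e' : e \in G -> e' \in G ->
  lat (gens H) ((rhov e *~ ev s (rhov e') - rhov e' *~ ev s (rhov e)) *+ 2).
Proof.
move=> eG eG'; apply: lat_dual2 => C' L' CH' bL'.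
rewrite evB !evMz -[X in X - _]mulrzr -[X in _ - X]mulrzr !intz prop //.
by rewrite [ev s _ * _]mulrC subrr.
Qed.

Lemma prop_lat_F2 e e' (m : nat) : e \in G :\: H -> e' \in G :\: H ->
  ev s (rhov e) = ev s (rhov e') *+ m ->
  (forall t : {ffun 'I_n -> 'F_2}, kills t H -> ev t (rhov e) = ev t (rhov e') *+ m) ->
  lat (gens H) (rhov e - rhov e' *+ m).
Proof.
move=> eG eG' em tm; apply: lat_dual_F2 => [C' L' CH' bL'|t tH]; last first.
  by rewrite evB evMn tm // subrr.
have := prop CH' bL' (inG eG) (inG eG'); rewrite em mulrC -mulr_natr.
rewrite -mulrA => /(mulfI (lt0r_neq0 (pos eG'))) E.
by rewrite evB evMn E mulr_natl subrr.
Qed.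

(** If an F_2 functional t killing H separated two edges of value 1, then t and the indicator of C
    would be independent modulo the functionals killing G, and comp(H) would be at least comp(G) +
    2. *)
Lemma comp_small_generator : facet_subgraph G H -> (ncomp H <= (ncomp G).+1)%N ->
  exists2 e0, e0 \in G :\: H & forall e, e \in G :\: H ->
    lat (gens H) (rhov e - rhov e0) \/ lat (gens H) (rhov e - rhov e0 *+ 2).
Proof.
move=> facet small.
have [[e0 e0G s0]|no1] := EM (exists2 e0, e0 \in G :\: H & ev s (rhov e0) = 1).
  exists e0 => // e eG; case: (ev_sgn_bound (pos eG)) => se; [left|right]; last first.
    apply: prop_lat_F2 => // [|t tH]; first by rewrite se s0.
    by rewrite (ev_sgn_two CH tH se) -mulr_natr F2_two mulr0.
  rewrite -[rhov e0]mulr1n; apply: prop_lat_F2 => // [|t tH]; first by rewrite se s0.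
  rewrite mulr1n; apply/eqP; apply: contraTT small => tee0; rewrite -ltnNge.
  rewrite -(ltn_exp2l (m := 2)) //.
  (* This embeds ker G x F_2 x F_2 into ker H: the values at e and e0 recover both scalars, because
     t differs at the two edges while [ind] is 1 at both. *)
  pose f (x : {ffun 'I_n -> 'F_2} * ('F_2 * 'F_2)) : {ffun 'I_n -> 'F_2} :=
    [ffun i => x.1 i + x.2.1 * t i + x.2.2 * ind i].
  have evf x v : ev (f x) v = ev x.1 v + x.2.1 * ev t v + x.2.2 * ev ind v.
    by rewrite -!ev_lin; apply: eq_ev => i; rewrite ffunE.
  have : (#|f @: setX (ker_set 'F_2 G) setT| <= #|ker_set 'F_2 H|)%N.
    apply: subset_leq_card; apply/subsetP => _ /imsetP [x + ->].
    rewrite inE => /andP [xG _]; apply/ker_setP => d dH; rewrite evf tH // ind_kill //.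
    by rewrite (ker_setP _ _ (subsetP (ker_set_sub _ HG) _ xG)) // !mulr0 !addr0.
  rewrite card_in_imset; last first.
    move=> [w [a b]] [w' [a' b']] /setXP [/ker_setP wG _] /setXP [/ker_setP wG' _] ff'.
    have := congr1 (fun g : {ffun 'I_n -> 'F_2} => ev g (rhov e)) ff'.
    have := congr1 (fun g : {ffun 'I_n -> 'F_2} => ev g (rhov e0)) ff'.
    rewrite !evf /= !ev_ind // !(wG _ (inG e0G)) !(wG' _ (inG e0G)) !(wG _ (inG eG)) !(wG' _ (inG eG)).
    rewrite !add0r !mulr1 => h0 h1.
    have aa : a = a'.
      apply/eqP; rewrite -subr_eq0; have : (a - a') * (ev t (rhov e) - ev t (rhov e0)) = 0.
        have -> : (a - a') * (ev t (rhov e) - ev t (rhov e0)) =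
          (a * ev t (rhov e) + b) - (a' * ev t (rhov e) + b')
          - ((a * ev t (rhov e0) + b) - (a' * ev t (rhov e0) + b')) by ring.
        by rewrite h0 h1 !subrr.
      by move/eqP; rewrite mulf_eq0 subr_eq0 [_ - _ == _]subr_eq0 (negbTE tee0) orbF.
    have bb : b = b' by move: h0; rewrite aa => /addrI.
    congr (_, (_, _)) => //; apply/ffunP => i.
    have := congr1 (fun g : {ffun 'I_n -> 'F_2} => g i) ff'.
    by rewrite !ffunE /= aa bb => /addIr /addIr.
  rewrite cardsX cardsT card_prod card_Fp // !card_ker_F2; apply: leq_trans.
  rewrite (_ : (2 * 2)%N = (2 ^ 2)%N) // -expnD ltn_exp2l //; lia.
(* Every edge outside H then has value 2, and any one of them serves as e0. *)
have all2 e : e \in G :\: H -> ev s (rhov e) = 2.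
  by move=> eG; case: (ev_sgn_bound (pos eG)) => // s1; case: no1; exists e.
have [e0 e0G] := facet_proper facet; exists e0 => // e eG; left.
rewrite -[rhov e0]mulr1n; apply: prop_lat_F2 => // [|t tH]; first by rewrite !all2.
by rewrite mulr1n (ev_sgn_two CH tH (all2 _ eG)) (ev_sgn_two CH tH (all2 _ e0G)).
Qed.

(** Otherwise every F_2 functional killing H is constant on the edges of value 1. Subtracting that
    constant times the indicator of C gives a functional killing G, so ker H embeds in ker G x
    F_2. *)
Lemma comp_big_witness : ((ncomp G).+1 < ncomp H)%N ->
  exists e1 e2, [/\ e1 \in G :\: H, e2 \in G :\: H, ev s (rhov e1) = 1, ev s (rhov e2) = 1 &
    ~ lat (gens H) (rhov e1 - rhov e2)].
Proof.
move=> big; apply: contrapT => no.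
have const e e' (t : {ffun 'I_n -> 'F_2}) : e \in G :\: H -> e' \in G :\: H ->
    ev s (rhov e) = 1 -> ev s (rhov e') = 1 -> kills t H -> ev t (rhov e) = ev t (rhov e').
  move=> eG eG' s1 s1' tH; apply/eqP; rewrite -subr_eq0 -evB; apply/eqP.
  by apply: (kills_lat tH); apply: contrapT => nl; apply: no; exists e, e'.
move: big; apply/negP; rewrite -leqNgt -(leq_exp2l (m := 2)) // expnS -!card_ker_F2.
have [[e0 e0G s0]|no1] := EM (exists2 e0, e0 \in G :\: H & ev s (rhov e0) = 1).
  pose f (t : {ffun 'I_n -> 'F_2}) : {ffun 'I_n -> 'F_2} * 'F_2 :=
    ([ffun i => t i + (- ev t (rhov e0)) * ind i], ev t (rhov e0)).
  have : (#|f @: ker_set 'F_2 H| <= #|setX (ker_set 'F_2 G) [set: 'F_2]|)%N.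
    apply: subset_leq_card; apply/subsetP => _ /imsetP [t /ker_setP tH ->].
    apply/setXP; split; last by rewrite inE.
    apply/ker_setP => e eG.
    have -> : ev (f t).1 (rhov e) = ev t (rhov e) + (- ev t (rhov e0)) * ev ind (rhov e).
      by rewrite -ev_lin; apply: eq_ev => i; rewrite ffunE.
    have [eH|neH] := boolP (e \in H).
      by rewrite tH // ind_kill // mulr0 addr0.
    have eGH : e \in G :\: H by rewrite inE neH.
    case: (ev_sgn_bound (pos eGH)) => se.
      by rewrite (ev_ind se) mulr1 (const e e0 t) // subrr.
    by rewrite (ev_sgn_two CH tH se) (ev_sgn_two CH ind_kill se) mulr0 addr0.
  rewrite card_in_imset; last first.
    move=> t t' _ _ [/ffunP tt' ee]; apply/ffunP => i; have := tt' i.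
    by rewrite !ffunE ee => /addIr.
  by rewrite cardsX cardsT card_Fp // mulnC.
apply: (@leq_trans #|ker_set 'F_2 G|); last by rewrite leq_pmull.
apply: subset_leq_card; apply/subsetP => t /ker_setP tH; apply/ker_setP => e eG.
have [eH|neH] := boolP (e \in H); first exact: tH.
have eGH : e \in G :\: H by rewrite inE neH.
case: (ev_sgn_bound (pos eGH)) => se; first by case: no1; exists e.
exact: (ev_sgn_two CH tH se).
Qed.

End CompCount.
End Facet.

(** * A Gordan alternative modulo the lattice of a subgraph *)

Section Gordan.
Variables (n : nat) (H : {set edge n}).
Notation vec := 'rV[int]_n.
Implicit Types (vs : seq vec) (t s r : 'I_n -> int).

(** Sums with at least one term: the empty sum would satisfy the second alternative of [gordan]
    trivially. *)
Definition cone_pos vs a := exists v u, [/\ v \in vs, cone vs u & a = v + u].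

Lemma separate (u : vec) : (exists2 t : 'I_n -> int, kills t H & 0 < ev t u) \/ lat (gens H) (u *+ 2).
Proof.
have [[C [L [CH bL fu]]]|no] := EM (exists C L, [/\ C \in comps H,
    is_bipartition (aug_edges H) C L & ev (sgn C L) u != 0]); last first.
  right; apply: lat_dual2 => C L CH bL; apply: contrapT => /eqP fu.
  by apply: no; exists C, L.
left; have kf := sgn_kills CH bL.
move: fu; rewrite neq_lt => /orP [fu|fu]; last by exists (sgn C L).
exists (fun i => -1 * sgn C L i); last by rewrite ev_scale mulN1r oppr_gt0.
by move=> e eH; rewrite ev_scale kf // mulr0.
Qed.

(** A large multiple of t absorbs the values of s on vs and contributes nothing at u, where s is
    positive. *)
Lemma perturb vs u t s : kills t H -> (forall v, v \in vs -> 0 < ev t v) -> ev t u = 0 ->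
  kills s H -> 0 < ev s u ->
  exists2 r : 'I_n -> int, kills r H & forall v, v \in u :: vs -> 0 < ev r v.
Proof.
move=> tH tvs tu sH su.
pose N := 1 + \sum_(v <- vs) `|ev s v|.
exists (fun i => s i + N * t i); first by move=> e eH; rewrite ev_lin sH // tH // mulr0 addr0.
move=> v; rewrite inE ev_lin => /orP [/eqP ->|vvs]; first by rewrite tu mulr0 addr0.
have tv := tvs v vvs.
have Nv : 1 + `|ev s v| <= N.
  by rewrite /N (big_rem v) //= lerD2l lerDl sumr_ge0.
have abs_le (x y N' : int) : 1 + `|x| <= N' -> 0 < y -> 0 < x + N' * y by nia.
exact: abs_le.
Qed.

Lemma cone_sub vs ws : {subset vs <= ws} -> forall a, cone vs a -> cone ws a.
Proof. by move=> sub; apply: NN_incl => v /sub; exact: NN_gen. Qed.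

(** Induction on the number of vectors, as in Fourier-Motzkin elimination: if the functional t found
    for vs is negative at u, then vs is projected along u to the kernel of t and the induction
    hypothesis is applied again. *)
Lemma gordan vs : (exists2 t : 'I_n -> int, kills t H & forall v, v \in vs -> 0 < ev t v) \/
  (exists2 a, cone_pos vs a & lat (gens H) a).
Proof.
have [m] := ubnP (size vs); elim: m vs => // m IH [|u vs] /= sz.
  by left; exists (fun=> 0) => // e _; rewrite /ev big1 // => i _; rewrite mul0r.
have [[s sH su]|lu] := separate u; last first.
  right; exists (u *+ 2) => //; exists u, u; rewrite mulr2n mem_head; split=> //.
  by apply: NN_gen; rewrite mem_head.
have sub : {subset vs <= u :: vs} by move=> v vvs; rewrite inE vvs orbT.
case: (IH vs sz) => [[t tH tvs]|[_ [v [w [vvs vw ->]]] la]]; last first.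
  right; exists (v + w) => //; exists v, w; rewrite sub //; split=> //.
  exact: cone_sub vw.
have [tu|tu|tu] := ltrgtP (ev t u) 0; last by left; exact: perturb tH tvs tu sH su.
  (* As -t(u) is a positive integer, p v is v plus nonnegative multiples of v and u; a relation
     among the projections is thus one among u and vs. *)
  pose p v := v *~ (- ev t u) + u *~ ev t v.
  case: (IH (map p vs)); first by rewrite size_map.
    move=> [r rH rvs]; left.
    (* This combination vanishes at u, and its value at v is that of r at p v. *)
    apply: (perturb (t := fun i => ev r u * t i + (- ev t u) * r i) _ _ _ sH su).
    - by move=> e eH; rewrite ev_lin ev_scale tH // rH // !mulr0 addr0.
    - move=> v vvs; rewrite ev_lin ev_scale.
      have := rvs (p v) (map_f p vvs); rewrite /p evD !evMzr !intz.
      by rewrite [ev r v * _]mulrC addrC.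
    - by rewrite ev_lin ev_scale mulNr [ev r u * _]mulrC subrr.
  move=> [_ [w [c [/mapP [v vvs ->] cc ->]]] lc]; right; exists (p v + c) => //.
  have tunat : exists m', - ev t u = m'.+1%:Z by exists (absz (ev t u)).-1; lia.
  have pE w' : w' \in vs -> exists2 b, cone (u :: vs) b & p w' = w' + b.
    move=> wvs; have tw := tvs w' wvs; case: tunat => m' Em.
    have [m2 Em2] : exists m2, ev t w' = m2%:Z by exists (absz (ev t w')); lia.
    exists (w' *+ m' + u *+ m2); last by rewrite /p Em Em2 -!pmulrn mulrS addrA.
    by apply: NND; apply: NNMn; apply: NN_gen; [exact: sub | rewrite mem_head].
  have [b cb ->] := pE v vvs; exists v, (b + c); rewrite sub // addrA; split=> //.
  apply: NND => //; apply: NN_incl cc => _ /mapP [x xvs ->].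
  have [d cd ->] := pE x xvs; apply: NND => //; apply: NN_gen; exact: sub.
by left; exists t => // v; rewrite inE => /orP [/eqP ->|/tvs].
Qed.

End Gordan.

(** * Facets from maximal supporting functionals *)

Section ExistsFacet.
Variables (n : nat) (G : {set edge n}).
Notation vec := 'rV[int]_n.
Implicit Types (t s r : 'I_n -> int).

Definition nonneg_fun t : Prop :=
  (forall e, e \in G -> 0 <= ev t (rhov e)) /\ exists2 e, e \in G & 0 < ev t (rhov e).
Definition zero_set t : {set edge n} := [set e in G | ev t (rhov e) == 0].
(** A functional that cuts out a facet: inclusion-maximality of the proper face replaces any mention
    of dimension. *)
Definition maximal_fun t : Prop :=
  nonneg_fun t /\ forall s, nonneg_fun s -> zero_set t \subset zero_set s ->
    zero_set s \subset zero_set t.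

Lemma exists_maximal_fun t : nonneg_fun t ->
  exists2 s : 'I_n -> int, maximal_fun s & zero_set t \subset zero_set s.
Proof.
have [m] := ubnP (#|G| - #|zero_set t|); elim: m t => // m IH t lt_m tG.
have [max|nmax] := EM (maximal_fun t); first by exists t.
have [s [sG ts nst]] : exists s, [/\ nonneg_fun s, zero_set t \subset zero_set s &
    ~~ (zero_set s \subset zero_set t)].
  apply: contrapT => no; apply: nmax; split=> // s sG ts; apply: contrapT => /negP nst.
  by apply: no; exists s.
have [|r rm sr] := IH s _ sG; last by exists r => //; exact: subset_trans ts sr.
have lt1 : (#|zero_set t| < #|zero_set s|)%N by apply: proper_card; apply/properP; split=> //; apply/subsetPn.
have lt2 : (#|zero_set s| <= #|G|)%N by apply: subset_leq_card; apply/subsetP => e; rewrite inE => /andP [].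
by move: lt_m; lia.
Qed.

Section MaximalFun.
Variable t : 'I_n -> int.
Hypothesis tmax : maximal_fun t.
Let H := zero_set t.

Let HG : H \subset G. Proof. by apply/subsetP => e; rewrite inE => /andP []. Qed.
Let tH : kills t H. Proof. by move=> e; rewrite inE => /andP [_ /eqP]. Qed.
Let tpos e : e \in G -> e \notin H -> 0 < ev t (rhov e).
Proof. by move=> eG; rewrite inE eG /= => e0; rewrite lt0r e0 tmax.1.1. Qed.

(** Let e0 minimize the ratio of s to t over the edges outside H. Then t(e0) s - s(e0) t is
    nonnegative on G and vanishes on H and at e0; by maximality it vanishes on all of G. *)
Lemma maximal_fun_prop s : kills s H -> forall e e', e \in G -> e' \in G ->
  ev s (rhov e) * ev t (rhov e') = ev t (rhov e) * ev s (rhov e').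
Proof.
move=> sH; have [e1 e1G t1] := tmax.1.2.
pose q e : rat := (ev s (rhov e))%:~R / (ev t (rhov e))%:~R.
have e1P : (e1 \in G) && (e1 \notin H) by rewrite e1G inE e1G /= lt0r_neq0.
case: (@arg_minP _ _ _ e1 (fun e => (e \in G) && (e \notin H)) q e1P) => e0 /andP [e0G ne0] min0.
have t0 := tpos e0G ne0.
have ge e : e \in G -> 0 <= ev s (rhov e) * ev t (rhov e0) - ev s (rhov e0) * ev t (rhov e).
  move=> eG; have [eH|neH] := boolP (e \in H); first by rewrite (sH _ eH) (tH eH) mul0r mulr0 subrr.
  have te := tpos eG neH; have := min0 e; rewrite eG neH => /(_ isT).
  rewrite /q ler_pdivrMr ?ltr0z // mulrAC ler_pdivlMr ?ltr0z // -!rmorphM /= ler_int.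
  by rewrite subr_ge0.
pose r i := ev t (rhov e0) * s i + (- ev s (rhov e0)) * t i.
have rE e : ev r (rhov e) = ev s (rhov e) * ev t (rhov e0) - ev s (rhov e0) * ev t (rhov e).
  by rewrite /r ev_lin ev_scale mulrC mulNr.
have r0 e : e \in G -> ev r (rhov e) = 0.
  move=> eG; apply/eqP; apply: contraT => re.
  have rG : nonneg_fun r.
    split=> [f fG|]; first by rewrite rE ge.
    by exists e => //; rewrite lt0r re rE ge.
  have : H \subset zero_set r.
    apply/subsetP => f fH; by rewrite inE (subsetP HG) // rE (sH _ fH) (tH fH) mul0r mulr0 subrr eqxx.
  move=> /(tmax.2 _ rG) /subsetP /(_ e0).
  by rewrite inE e0G rE subrr eqxx => /(_ isT) e0H; rewrite e0H in ne0.
move=> e e' eG eG'; have := r0 e eG; have := r0 e' eG'; rewrite !rE => /eqP.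
rewrite subr_eq0 => /eqP E' /eqP; rewrite subr_eq0 => /eqP E.
apply: (mulfI (lt0r_neq0 t0)).
transitivity (ev s (rhov e0) * ev t (rhov e) * ev t (rhov e')); first by rewrite -E; ring.
by rewrite mulrAC -E'; ring.
Qed.

(** An edge at C of value 0 has both endpoints in C, so by connectedness its vector lies in ZZ H;
    but t is positive on it. *)
Lemma maximal_fun_touch C L e : C \in comps H -> is_bipartition (aug_edges H) C L ->
  e \in G :\: H -> ~~ avoids C e -> ev (sgn C L) (rhov e) != 0.
Proof.
move=> CH bL; rewrite inE => /andP [neH eG] touch; apply/eqP => se.
have kf := sgn_kills CH bL.
suff h : lat (gens H) (rhov e) by have := tpos eG neH; rewrite (kills_lat tH h) ltxx.
have two i j : inl i \in C -> inl j \in C ->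
    (sgn C L i + sgn C L j = 0 -> lat (gens H) (dvec i + dvec j)) /\
    (sgn C L j - sgn C L i = 0 -> lat (gens H) (dvec j - dvec i)).
  move=> iC jC; have nz : sgn C L i != 0 by rewrite /sgn /sgnf iC; case: ifP.
  case: (connect_lat (comp_connect CH iC jC)) => /= h; split=> // ss.
  - have := kills_lat kf h; rewrite evB !ev_dvec => s2; move/eqP: nz; lia.
  - by rewrite addrC.
  - have := kills_lat kf h; rewrite evD !ev_dvec => s2; move/eqP: nz; lia.
move: touch se; rewrite ev_rhov; case: e neH eG => [[[i j]|[i j]]|[i j]] neH eG /=;
  rewrite negb_and !negbK.
- case: (sgn_spec C L i) => -[si iC]; case: (sgn_spec C L j) => -[sj jC]; rewrite si sj ?(negbTE iC) ?(negbTE jC) //;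
  by move=> _ _; rewrite rhov_pos; apply: (two i j iC jC).1; rewrite si sj.
- case: (sgn_spec C L i) => -[si iC]; case: (sgn_spec C L j) => -[sj jC]; rewrite si sj ?(negbTE iC) ?(negbTE jC) //;
  by move=> _ _; rewrite rhov_neg; apply: ZZN; apply: (two i j iC jC).1; rewrite si sj.
- case: (sgn_spec C L i) => -[si iC]; case: (sgn_spec C L j) => -[sj jC]; rewrite si sj ?(negbTE iC) ?(negbTE jC) //;
  by move=> _ _; rewrite rhov_dir; apply: (two i j iC jC).2; rewrite si sj.
Qed.

Lemma sgn_compl (C L : {set avert n}) i : sgn C (C :\: L) i = - sgn C L i.
Proof.
rewrite /sgn /sgnf; case: ifP => [iC|_]; last by rewrite oppr0.
by rewrite !inE iC andbT; case: (inl i \in L); rewrite ?opprK.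
Qed.

Lemma bipartition_compl C L : C \in comps H -> is_bipartition (aug_edges H) C L ->
  is_bipartition (aug_edges H) C (C :\: L).
Proof.
move=> CH /andP [LC /forallP bL]; apply/andP; split; first exact: subsetDl.
apply/forallP => -[[s x] y]; apply/implyP => a; have := bL (s, x, y); rewrite a /=.
move=> /implyP h; apply/implyP => xyC; have := h xyC; rewrite !inE.
have xy := comp_adj CH (adj_edge a); move: xyC; rewrite -xy orbb => ->.
by rewrite !andbT; case: (x \in L); case: (y \in L).
Qed.

(** On G sigma is a multiple of t, nonzero at an edge touching C, so it has one sign on all edges
    outside H. Exchanging L with its complement in C makes that sign positive. *)
Lemma maximal_fun_pos C : C \in comps H -> bipartite (aug_edges H) C -> ~~ is_comp_of G H C ->
  exists2 L, is_bipartition (aug_edges H) C L &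
    forall e, e \in G :\: H -> 0 < ev (sgn C L) (rhov e).
Proof.
move=> CH /existsP [L bL] nC.
have [e eGH touch] : exists2 e, e \in G :\: H & ~~ avoids C e.
  apply: contrapT => no; case/negP: nC; apply: is_comp_of_out => // e eGH.
  by apply: contrapT => /negP touch; apply: no; exists e.
have se := maximal_fun_touch CH bL eGH touch.
have kf := sgn_kills CH bL.
move: (eGH); rewrite inE => /andP [neH eG]; have te := tpos eG neH.
have sgnE f : f \in G :\: H -> 0 < ev (sgn C L) (rhov f) * ev (sgn C L) (rhov e).
  rewrite inE => /andP [nfH fG]; have tf := tpos fG nfH.
  have E := maximal_fun_prop kf fG eG.
  rewrite -(pmulr_rgt0 _ te).
  have -> : ev t (rhov e) * (ev (sgn C L) (rhov f) * ev (sgn C L) (rhov e)) =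
    ev t (rhov f) * (ev (sgn C L) (rhov e) * ev (sgn C L) (rhov e)).
    by rewrite mulrA [ev t (rhov e) * _]mulrC E mulrA.
  by rewrite pmulr_rgt0 // lt0r mulf_neq0 //= sqr_ge0.
move: se; rewrite neq_lt => /orP [se|se]; last first.
  by exists L => // f /sgnE; rewrite pmulr_lgt0.
exists (C :\: L); first exact: bipartition_compl.
move=> f /sgnE; rewrite nmulr_lgt0 // => sf.
have -> : ev (sgn C (C :\: L)) (rhov f) = ev (fun i => -1 * sgn C L i) (rhov f).
  by apply: eq_ev => i; rewrite sgn_compl mulN1r.
by rewrite ev_scale mulN1r oppr_gt0.
Qed.

(** Counted over F_3: the functionals killing H are those killing G plus the multiples of the
    reduction of sigma, one dimension more. *)
Lemma maximal_fun_nbicomp : nbicomp H = (nbicomp G).+1.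
Proof.
have [e1 e1G t1] := tmax.1.2.
have [C [CH bip nC]] : exists C, [/\ C \in comps H, bipartite (aug_edges H) C & ~~ is_comp_of G H C].
  apply: contrapT => noC.
  have : lat (gens H) (rhov e1 *+ 2).
    apply: lat_dual2 => C L CH bL; apply: (is_comp_of_kills CH _ bL e1G).
    apply: contrapT => /negP nC; apply: noC; exists C; split=> //; apply/existsP; by exists L.
  by move/(kills_lat tH); rewrite evMn; lia.
have [L bL pos] := maximal_fun_pos CH bip nC.
have e1GH : e1 \in G :\: H by rewrite inE e1G andbT inE e1G /= lt0r_neq0.
set s := sgn C L in pos.
have prop : proportional_kills G H s.
  move=> C' L' CH' bL' e e' eG eG'.
  have P := maximal_fun_prop (sgn_kills CH bL); have P' := maximal_fun_prop (sgn_kills CH' bL').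
  apply: (mulfI (lt0r_neq0 t1)); apply: (mulfI (lt0r_neq0 t1)).
  transitivity ((ev (sgn C' L') (rhov e) * ev t (rhov e1)) * (ev s (rhov e') * ev t (rhov e1))); first by ring.
  rewrite P' // P //.
  transitivity ((ev (sgn C' L') (rhov e') * ev t (rhov e1)) * (ev s (rhov e) * ev t (rhov e1))); last by ring.
  by rewrite P' // P //; ring.
pose sb : {ffun 'I_n -> 'F_3} := [ffun i => (s i)%:~R].
have sbE v : ev sb v = (ev s v)%:~R.
  rewrite rmorph_sum; apply: eq_bigr => i _ /=; by rewrite ffunE rmorphM /= intz.
have sbH : kills sb H by move=> e eH; rewrite sbE (sgn_kills CH bL).
(* Both possible values, 1 and 2, are nonzero modulo 3. *)
have sb1 : ev sb (rhov e1) != 0.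
  by rewrite sbE; case: (ev_sgn_bound (pos e1 e1GH)) => ->.
pose f (x : {ffun 'I_n -> 'F_3} * 'F_3) : {ffun 'I_n -> 'F_3} := [ffun i => x.1 i + x.2 * sb i].
have evf x v : ev (f x) v = ev x.1 v + x.2 * ev sb v.
  by rewrite -ev_lin; apply: eq_ev => i; rewrite ffunE.
have inj : {in setX (ker_set 'F_3 G) setT &, injective f}.
  move=> [w c] [w' c'] /setXP [/ker_setP wG _] /setXP [/ker_setP wG' _] ff'.
  have := congr1 (fun g : {ffun 'I_n -> 'F_3} => ev g (rhov e1)) ff'.
  rewrite !evf /= wG // wG' // !add0r => /(mulIf sb1) cc; congr (_, _) => //.
  apply/ffunP => i; have := congr1 (fun g : {ffun 'I_n -> 'F_3} => g i) ff'.
  by rewrite !ffunE /= cc => /addIr.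
have im : f @: setX (ker_set 'F_3 G) setT = ker_set 'F_3 H.
  apply/setP => r; apply/imsetP/ker_setP => [[[w c] /setXP [/ker_setP wG _] ->] e eH|rH].
    by rewrite evf /= wG ?(subsetP HG) // sbH // mulr0 addr0.
  pose c := ev r (rhov e1) / ev sb (rhov e1).
  pose w : {ffun 'I_n -> 'F_3} := [ffun i => r i + (- c) * sb i].
  exists (w, c); last by apply/ffunP => i; rewrite !ffunE /= mulNr subrK.
  apply/setXP; split; last by rewrite inE.
  apply/ker_setP => e eG.
  have -> : ev w (rhov e) = ev r (rhov e) + (- c) * ev sb (rhov e).
    by rewrite -ev_lin; apply: eq_ev => i; rewrite ffunE.
  have := kills_lat rH (prop_lat prop eG e1G).
  rewrite evMn evB !evMzr -!sbE -mulr_natr => /eqP.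
  rewrite mulf_eq0 => /orP [|/eqP //]; rewrite subr_eq0 => /eqP E.
  by rewrite /c mulNr mulrAC -E mulfK // subrr.
have := card_in_imset inj; rewrite im cardsX cardsT card_Fp // !card_ker_F3 -expnSr.
by move/eqP; rewrite eqn_exp2l // => /eqP.
Qed.

Lemma maximal_fun_facet : facet_subgraph G H.
Proof.
rewrite /facet_subgraph HG maximal_fun_nbicomp eqxx /=.
apply/forall_inP => C CH; apply/implyP => /andP [bip nC].
have [L bL pos] := maximal_fun_pos CH bip nC; apply/existsP; exists L; rewrite bL /=.
apply/forall_inP => e eGH; rewrite good_edgeP; first exact: pos.
by case/andP: bL.
Qed.

End MaximalFun.

Lemma exists_facet (H0 : {set edge n}) : H0 \subset G -> (exists e, e \in G :\: H0) ->
  (forall a, cone_pos (gens (G :\: H0)) a -> ~ lat (gens H0) a) ->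
  exists2 H, facet_subgraph G H & H0 \subset H.
Proof.
move=> HG0 [e1 e1G] no.
case: (gordan H0 (gens (G :\: H0))) => [[t tH tpos]|[a /no]] //.
have e1P : 0 < ev t (rhov e1) by apply: tpos; exact: mem_gens.
have tG : nonneg_fun t.
  split; last by exists e1 => //; move: e1G; rewrite inE => /andP [].
  move=> e eG; have [eH|neH] := boolP (e \in H0); first by rewrite tH.
  by apply/ltW/tpos/mem_gens; rewrite inE neH.
have [s smax ts] := exists_maximal_fun tG.
exists (zero_set s); first exact: maximal_fun_facet.
apply: subset_trans ts; apply/subsetP => e eH.
by rewrite inE (subsetP HG0) // tH // eqxx.
Qed.

End ExistsFacet.

(** * The prime ideal of a facet *)

Lemma cancel_shift (K : fieldType) (x y g u v : K) : y != 0 ->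
  y^-1 * x * g * u * (v * y) = x * (g * v * u).
Proof. by move=> y0; field. Qed.

Section FacePrime.
Variables (k : fieldType) (n : nat).
Notation F := (LFrac k n).
Notation vec := 'rV[int]_n.
Notation lX := (@lX k n).
Notation span := (@span k n).
Implicit Types (a b u v : vec) (D E : vec -> Prop) (x y z : F) (t : 'I_n -> int).

Lemma edge_ring_span (G : {set edge n}) : @edge_ring k n G = span (cone (gens G)).
Proof.
apply: funext => x; apply: propext; split.
  elim=> [c|e eG|y z _ Sy _ Sz|y z _ Sy _ Sz].
  - rewrite -[X in span _ X]addr0 -[X in X + _]mulr1 -(lX0 k n).
    by constructor; [exact: NN0 | constructor].
  - rewrite (@lX_eq k n (rho e) (rhov e)); last by move=> i; rewrite mxE.
    by apply: spanX; apply: NN_gen; exact: mem_gens.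
  - exact: spanD.
  - exact: (subringM (span_NN_subring k _)).
elim=> [|c a y ca _ Gy]; first by rewrite -(lC0 k n); exact: er_const.
apply: er_add => //; apply: er_mul; first exact: er_const.
elim: ca => [|v b /gensP [e eG ->] _ IH].
  by rewrite lX0 -(lC1 k n); exact: er_const.
rewrite lXD; apply: er_mul => //.
by rewrite -(@lX_eq k n (rho e) (rhov e)); [exact: er_gen | move=> i; rewrite mxE].
Qed.

Lemma span_and D E x : span D x -> span E x -> span (fun a => D a /\ E a) x.
Proof.
move=> /(span_split E) [y [z [Dy Dz ->]]] Eyz.
suff -> : z = 0 by rewrite addr0.
apply: (span_disjoint (D := E) (E := fun a => D a /\ ~ E a)) => //; last by move=> a Ea [].
have -> : z = (y + z) - y by rewrite addrC addKr.
by apply: spanB => //; apply: span_mono Dy => a [].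
Qed.

(** No monomial of y can cancel one of z, so a condition on the support of the sum passes to each
    summand. *)
Lemma span_part D E (A : vec -> Prop) y z : span D y -> span E z ->
  (forall a, D a -> E a -> False) -> span A (y + z) -> span A y /\ span A z.
Proof.
move=> Dy Ez dis Ayz.
have [y1 [y2 [Ay1 Ay2 Ey]]] := span_split A Dy.
have [z1 [z2 [Az1 Az2 Ez']]] := span_split A Ez.
have A1 : span A (y1 + z1).
  by apply: spanD; [apply: span_mono Ay1 => a [] | apply: span_mono Az1 => a []].
have s0 : y2 + z2 = 0.
  apply: (span_disjoint (D := A) (E := fun a => ~ A a)) => //.
    have -> : y2 + z2 = (y + z) - (y1 + z1) by rewrite Ey Ez'; ring.
    exact: spanB.
  by apply: spanD; [apply: span_mono Ay2 => a [] | apply: span_mono Az2 => a []].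
have y20 : y2 = 0.
  apply: (span_disjoint (D := D) (E := E)) => //; first by apply: span_mono Ay2 => a [].
  have -> : y2 = - z2 by apply/eqP; rewrite -addr_eq0 s0.
  by apply: spanN; apply: span_mono Az2 => a [].
have z20 : z2 = 0 by rewrite -[z2]add0r -y20 s0.
rewrite Ey Ez' y20 z20 !addr0.
by split; [apply: span_mono Ay1 => a [] | apply: span_mono Az1 => a []].
Qed.

(* The lowest homogeneous parts of two factors multiply to the lowest part of the product. *)
Lemma span_pos_prime D t x y :
  (forall a b, D a -> D b -> D (a + b)) -> (forall a, D a -> 0 <= ev t a) ->
  span D x -> span D y -> span (fun a => 0 < ev t a) (x * y) ->
  span (fun a => D a /\ 0 < ev t a) x \/ span (fun a => D a /\ 0 < ev t a) y.
Proof.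
move=> DD D0 Dx Dy Pxy.
have [x1 [x0 [x1P x0P Ex]]] := span_split (fun a => 0 < ev t a) Dx.
have [y1 [y0 [y1P y0P Ey]]] := span_split (fun a => 0 < ev t a) Dy.
have : x0 * y0 = 0.
  apply: (span_disjoint (D := fun a => 0 < ev t a) (E := fun a => ~ 0 < ev t a)) => //.
    have -> : x0 * y0 = x * y - (x1 * y + x0 * y1) by rewrite Ex Ey; ring.
    apply: spanB => //; apply: spanD.
      by apply: spanM x1P Dy => a b [_ pa] /D0 pb; rewrite evD ltr_wpDr.
    by apply: spanM x0P y1P => a b [/D0 pa _] [_ pb]; rewrite evD ltr_wpDl.
  by apply: spanM x0P y0P => a b [Da na] [Db nb]; rewrite evD; have := D0 a Da; have := D0 b Db; lia.
move/eqP; rewrite mulf_eq0 => /orP [/eqP x00|/eqP y00]; [left|right].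
  by rewrite Ex x00 addr0.
by rewrite Ey y00 addr0.
Qed.

Lemma lX_not_pos t a : ev t a = 0 -> ~ span (fun a => 0 < ev t a) (lX a).
Proof.
move=> ta Pa; have := lX_neq0 k a; case/eqP.
apply: (span_disjoint (E := fun a => ev t a = 0) Pa); first exact: spanX.
by move=> b + b0; rewrite b0 ltxx.
Qed.

Section Face.
Variables (vs : seq vec) (t : 'I_n -> int).
Hypothesis t_ge0 : forall v, v \in vs -> 0 <= ev t v.

Definition face_ideal : F -> Prop := span (fun a => cone vs a /\ 0 < ev t a).

Lemma cone_ge0 a : cone vs a -> 0 <= ev t a.
Proof.
elim=> [|v b /t_ge0 tv _ IH]; first by rewrite ev0.
by rewrite evD addr_ge0.
Qed.

Lemma face_ideal_pos x : face_ideal x -> span (fun a => 0 < ev t a) x.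
Proof. by apply: span_mono => a []. Qed.

Lemma face_prime : is_prime (span (cone vs)) face_ideal.
Proof.
split; [split; [|split; [|split]] | split].
- by move=> x; apply: span_mono => a [].
- by constructor.
- by move=> x y; exact: spanD.
- move=> r x Sr Px; apply: spanM Sr Px => a b ca [cb pb]; split; first exact: NND.
  by rewrite evD ltr_wpDl // cone_ge0.
- rewrite -(lX0 k n) => /face_ideal_pos; apply: lX_not_pos; exact: ev0.
- move=> x y Sx Sy /face_ideal_pos; apply: span_pos_prime => //; last exact: cone_ge0.
  by move=> a b; exact: NND.
Qed.
End Face.

Section FacetIdeal.
Variables (G H : {set edge n}) (t : 'I_n -> int).
Hypothesis tH : kills t H.
Hypothesis tpos : forall e, e \in G :\: H -> 0 < ev t (rhov e).
Hypothesis HG : H \subset G.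
Let S := span (cone (gens G)).
Let P := face_ideal (gens G) t.
Let hS : is_subring S := span_NN_subring k (fun v => v \in gens G).

Lemma facet_ge0 v : v \in gens G -> 0 <= ev t v.
Proof.
case/gensP => e eG ->; have [eH|neH] := boolP (e \in H); first by rewrite tH.
by apply/ltW/tpos; rewrite inE neH.
Qed.

Let hP : is_prime S P. Proof. exact: face_prime facet_ge0. Qed.

Lemma cone_dich a : cone (gens G) a -> (cone (gens H) a /\ ev t a = 0) \/
  (exists e b, [/\ e \in G :\: H, cone (gens G) b & a = rhov e + b]).
Proof.
elim=> [|v b /gensP [e eG ->] cb IH]; first by left; split; [exact: NN0 | exact: ev0].
have [eH|neH] := boolP (e \in H); last by right; exists e, b; rewrite inE neH.
case: IH => [[cHb tb]|[f [c [fG cc ->]]]].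
  by left; rewrite evD tH // tb; split=> //; apply: NNS => //; exact: mem_gens.
right; exists f, (rhov e + c); rewrite addrCA; split=> //.
by apply: NNS => //; exact: mem_gens.
Qed.

Lemma cone_face a : cone (gens G) a -> ev t a <= 0 -> cone (gens H) a.
Proof.
move=> ca ta; case: (cone_dich ca) => [[] //|[e [b [eG cb Ea]]]].
have := tpos eG; have := cone_ge0 facet_ge0 cb; move: ta; rewrite Ea evD; lia.
Qed.

Lemma cone_pos_edge a : cone (gens G) a -> 0 < ev t a ->
  exists e b, [/\ e \in G :\: H, cone (gens G) b & a = rhov e + b].
Proof. by move=> ca ta; case: (cone_dich ca) => [[_ t0]|//]; rewrite t0 ltxx in ta. Qed.

Lemma coneH_G a : cone (gens H) a -> cone (gens G) a.
Proof. by apply: cone_sub; exact: gens_sub. Qed.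

Lemma coneH_ev a : cone (gens H) a -> ev t a = 0.
Proof. by move/NN_ZZ; exact: kills_lat. Qed.

Lemma coneH_notin a : cone (gens H) a -> ~ P (lX a).
Proof. by move/coneH_ev => ta /face_ideal_pos; exact: lX_not_pos. Qed.

Lemma face_ideal_sub Q : is_prime S Q -> (forall e, e \in G :\: H -> Q (lX (rhov e))) ->
  forall x, P x -> Q x.
Proof.
move=> hQ Qe x; elim=> [|c a y [ca ta] _ IH]; first exact: prime0 hQ.
apply: (primeD hQ) => //; have [e [b [eG cb ->]]] := cone_pos_edge ca ta.
rewrite lXD; apply: (primeMl hQ).
  rewrite -[lC n c]mulr1 -(lX0 k n) -[_ * _]addr0.
  by constructor; [exact: NN0 | constructor].
by apply: (primeMr hQ); [exact: Qe | exact: spanX].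
Qed.

Lemma face_ideal_edge e : e \in G :\: H -> P (lX (rhov e)).
Proof.
move=> eGH; apply: spanX; split; last exact: tpos.
by apply: NN_gen; apply: mem_gens; move: eGH; rewrite inE => /andP [].
Qed.

Lemma loc_lat a : lat (gens H) a -> localization S P (lX a).
Proof.
move=> /ZZ_diff [u [v [cu cv ->]]]; exists (lX u), (lX v).
split; first by apply: spanX; exact: coneH_G.
split; first by apply: spanX; exact: coneH_G.
by split; [exact: coneH_notin | rewrite lXB].
Qed.

(** Monomials with exponents in ZZ H are units at P, so each edge outside H contributes a unit times
    the first or second power of the monomial of e0. *)
Lemma facet_regular e0 : krull_dim_le (localization S P) 1 -> e0 \in G :\: H ->
  (forall e, e \in G :\: H ->
    lat (gens H) (rhov e - rhov e0) \/ lat (gens H) (rhov e - rhov e0 *+ 2)) ->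
  regular_local (localization S P).
Proof.
move=> dim1 e0G gen.
have Pe0 := face_ideal_edge e0G; have hA := loc_subring hS hP.
have Se0 : S (lX (rhov e0)) by exact: primeW hP _ Pe0.
apply: (regular_of_principal hS hP dim1 Pe0 (lX_neq0 _ _) (a := lX (rhov e0))) => y; split.
  move=> [p [q [Pp [Sq [Pq ->]]]]].
  have [r Ar ->] : exists2 r, localization S P r & p = r * lX (rhov e0).
    elim: Pp => [|c a z [ca ta] _ [r Ar ->]].
      by exists 0; [exact: subring0 | rewrite mul0r].
    have [e [b [eG cb ->]]] := cone_pos_edge ca ta.
    have [d Ad Ed] : exists2 d, localization S P d & lX (rhov e) = d * lX (rhov e0).
      case: (gen e eG) => /loc_lat h.
        by exists (lX (rhov e - rhov e0)) => //; rewrite -lXD subrK.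
      exists (lX (rhov e - rhov e0 *+ 2) * lX (rhov e0)).
        by apply: (subringM hA) => //; exact: loc_incl.
      by rewrite -!lXD -addrA -mulr2n subrK.
    exists (lC n c * lX b * d + r); last by rewrite lXD Ed; ring.
    apply: (subringD hA) => //; apply: (subringM hA) => //; apply: (loc_incl hS hP).
    by rewrite -[_ * _]addr0; constructor=> //; constructor.
  exists (r * q^-1); last by rewrite mulrAC.
  by apply: (subringM hA) => //; exact: loc_inv.
move=> [r Ar ->]; apply: (primeMl (locM_prime hS hP)) => //.
exact: loc_ideal_incl.
Qed.

Section Height.
Variable e1 : edge n.
Hypothesis e1G : e1 \in G :\: H.
Hypothesis t1 : ev t (rhov e1) = 1.
Hypothesis prop2 : forall e e', e \in G -> e' \in G ->
  lat (gens H) ((rhov e *~ ev t (rhov e') - rhov e' *~ ev t (rhov e)) *+ 2).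

Lemma prime_power Q x m : is_prime S Q -> S x -> Q (x ^+ m) -> Q x.
Proof.
move=> hQ Sx; have SX j : S (x ^+ j).
  by elim: j => [|j IH]; rewrite ?expr0 ?exprS; [exact: subring1 | exact: subringM].
elim: m => [|m IH]; first by rewrite expr0 => /(primeN1 hQ).
by rewrite exprS => /(prime_mul hQ Sx (SX m)) [|/IH].
Qed.

(** By [prop2] suitable powers of the two monomials agree up to monomials supported on H, which Q
    cannot contain because P does not. *)
Lemma facet_prime_edge Q e : is_prime S Q -> (forall x, Q x -> P x) ->
  e \in G :\: H -> Q (lX (rhov e)) -> forall e', e' \in G :\: H -> Q (lX (rhov e')).
Proof.
move=> hQ QP eGH Qe e' eGH'.
have inG f : f \in G :\: H -> f \in G by rewrite inE => /andP [].
have Srho f : f \in G :\: H -> S (lX (rhov f)).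
  by move=> /inG fG; apply: spanX; apply: NN_gen; exact: mem_gens.
have /ZZ_diff [u [v [cu cv E]]] := prop2 (inG _ eGH') (inG _ eGH).
have [m Em] : exists m, ev t (rhov e) = m%:Z by have := tpos eGH; exists (absz (ev t (rhov e))); lia.
have [m' Em'] : exists m', ev t (rhov e') = m'.+1%:Z.
  by have := tpos eGH'; exists (absz (ev t (rhov e'))).-1; lia.
have {}E : rhov e' *+ (m * 2) + v = rhov e *+ (m'.+1 * 2) + u.
  move: E; rewrite Em Em' -!pmulrn mulrnBl -!mulrnA => /eqP.
  by rewrite subr_eq => /eqP ->; rewrite addrAC subrK addrC.
have Su : S (lX u) by apply: spanX; exact: coneH_G.
have Sv : S (lX v) by apply: spanX; exact: coneH_G.
have SX f j : f \in G :\: H -> S (lX (rhov f *+ j)).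
  by move=> /inG fG; apply: spanX; apply: NNMn; apply: NN_gen; exact: mem_gens.
have : Q (lX (rhov e' *+ (m * 2)) * lX v).
  (* The multiplicity of rho(e) is twice t(e'), hence positive, so a factor lying in Q can be split
     off. *)
  rewrite -lXD E lXD mulSn -[(2 + _)%N]/((1 + (m' * 2)).+1) mulrS lXD.
  apply: (primeMr hQ) => //; apply: (primeMr hQ) => //; exact: SX.
case/(prime_mul hQ (SX _ _ eGH') Sv); last by move/QP => /(coneH_notin cv).
by rewrite lXMn; apply: prime_power => //; exact: Srho.
Qed.

(* The lattice [ZZ H + ZZ rho(e1)]: as [t] kills [H] and is 1 at [rho(e1)], the
   coefficient of [rho(e1)] can only be [ev t a]. *)
Definition base_lat a : Prop := lat (gens H) (a - rhov e1 *~ ev t a).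

(** The union of the cosets of the base lattice by subset sums of ws. For half periods it is a
    group, reached by extensions of index at most two, one for each step of the norm. *)
Fixpoint ext_lat (ws : seq vec) a : Prop :=
  if ws is w :: ws' then ext_lat ws' a \/ ext_lat ws' (a - w) else base_lat a.

Definition half_period w : Prop := base_lat (w *+ 2) /\ ev t w = 0.

Lemma base_latD a b : base_lat a -> base_lat b -> base_lat (a + b).
Proof.
by rewrite /base_lat evD mulrzDr opprD addrACA => ha hb; exact: ZZD.
Qed.

Lemma base_latN a : base_lat a -> base_lat (- a).
Proof. by rewrite /base_lat evN mulrNz -opprD; exact: ZZN. Qed.

Lemma base_ext ws a : base_lat a -> ext_lat ws a.
Proof. by move=> ba; elim: ws => [|w ws IH] //=; left. Qed.

Lemma ext_lat_group ws : (forall w, w \in ws -> half_period w) ->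
  (forall a b, ext_lat ws a -> ext_lat ws b -> ext_lat ws (a + b)) /\
  (forall a, ext_lat ws a -> ext_lat ws (- a)).
Proof.
elim: ws => [_|w ws IH hw]; first by split; [exact: base_latD | exact: base_latN].
have [|gD gN] := IH; first by move=> w' w'ws; apply: hw; rewrite inE w'ws orbT.
have w2 : ext_lat ws (w *+ 2) by apply: base_ext; case: (hw w (mem_head _ _)).
split=> [a b|a] /=.
  case=> ha [] hb; [left; exact: gD | right | right | left].
  - by rewrite -addrA; exact: gD.
  - by rewrite addrAC; exact: gD.
  - have := gD _ _ (gD _ _ ha hb) w2; congr (ext_lat _ _).
    by rewrite mulr2n addrACA !subrK.
case=> ha; [left; exact: gN | right].
have := gN _ (gD _ _ ha w2); congr (ext_lat _ _).
by rewrite mulr2n addrA subrK opprD.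
Qed.

Lemma ext_lat_mem ws w a : w \in ws -> base_lat (a - w) -> ext_lat ws a.
Proof.
elim: ws => // w' ws IH; rewrite inE => /orP [/eqP <-|wws] h /=.
  by right; exact: base_ext.
by left; exact: IH.
Qed.

(* If [w] is a half period and [f = a + b] with [a], [b] supported on the two
   cosets, then [(a + b) * (a - b) = a^2 - b^2] is supported on the smaller lattice. *)
Lemma norm_exists ws f : (forall w, w \in ws -> half_period w) ->
  span (fun a => ext_lat ws a /\ 0 <= ev t a) f -> ~ span (fun a => 0 < ev t a) f ->
  exists g, [/\ span (ext_lat ws) g,
    span (fun a => base_lat a /\ 0 <= ev t a) (f * g) & ~ span (fun a => 0 < ev t a) (f * g)].
Proof.
elim: ws f => [|w ws IH] f hw.
  move=> ef nf; exists 1; rewrite mulr1; split=> //.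
  rewrite -(lX0 k n); apply: spanX; rewrite /= /base_lat ev0 mulr0z subr0; exact: ZZ0.
have hws w' : w' \in ws -> half_period w' by move=> h; apply: hw; rewrite inE h orbT.
have [gD gN] := ext_lat_group hws.
have [gD' gN'] := ext_lat_group hw.
have [w2 tw] := hw w (mem_head _ _).
have {}w2 := base_ext ws w2.
(* If w is already in the group the extension is trivial and no conjugate is taken. *)
move=> ef nf; have [wws|nwws] := EM (ext_lat ws w).
  have [|g [sg fg nfg]] := IH f hws _ nf.
    apply: span_mono ef => a [[ha|ha] ta]; split=> //.
    by rewrite -[a](subrK w); exact: gD.
  by exists g; split=> //; apply: span_mono sg => a; left.
have [a [b [sa sb Ef]]] := span_split (ext_lat ws) ef.
have tD c d : 0 <= ev t c -> 0 <= ev t d -> 0 <= ev t (c + d) by rewrite evD; exact: addr_ge0.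
have sq : span (fun a => ext_lat ws a /\ 0 <= ev t a) (f * (a - b)).
  have -> : f * (a - b) = a * a - b * b by rewrite Ef; ring.
  apply: spanB.
    by apply: (spanM _ sa sa) => c d [[_ tc] hc] [[_ td] hd]; split; [exact: gD | exact: tD].
  apply: (spanM _ sb sb) => c d [[[//|hc] tc] nc] [[[//|hd] td] nd]; split; last exact: tD.
  have := gD _ _ (gD _ _ hc hd) w2; congr (ext_lat _ _).
  by rewrite mulr2n addrACA !subrK.
(* In degree 0 the product vanishes only if f or a - b does. As a and b have disjoint supports, the
   latter would put both in positive degree, and f = a + b with them. *)
have sqn : ~ span (fun a => 0 < ev t a) (f * (a - b)).
  move=> sp; have tspan D x : span (fun a => D a /\ 0 <= ev t a) x -> span (fun a => 0 <= ev t a) x.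
    by apply: span_mono => c [].
  have ta0 : span (fun a => 0 <= ev t a) a by apply: span_mono sa => c [] [].
  have tb0 : span (fun a => 0 <= ev t a) b by apply: span_mono sb => c [] [].
  case: (span_pos_prime (D := fun a => 0 <= ev t a) (t := t) _ _ (tspan _ _ ef) (spanB ta0 tb0) sp) => //.
  - by move=> h; apply: nf; apply: span_mono h => c [].
  - move=> h; apply: nf.
    have {}h : span (fun a => 0 < ev t a) (a - b) by apply: span_mono h => c [].
    have sa' : span (ext_lat ws) a by apply: span_mono sa => c [].
    have sb' : span (fun c => ~ ext_lat ws c) (- b) by apply: spanN; apply: span_mono sb => c [].
    have [|pa pb] := span_part sa' sb' _ h; first by move=> c hc /(_ hc).
    by rewrite Ef -[b]opprK; exact: spanB.
have [g [sg fg nfg]] := IH _ hws sq sqn.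
exists ((a - b) * g); rewrite mulrA; split=> //.
apply: (spanM (D := ext_lat (w :: ws)) (E := ext_lat (w :: ws))).
- exact: gD'.
- by apply: spanB; [apply: span_mono sa => c [] [] | apply: span_mono sb => c [] []].
- by apply: span_mono sg => c; left.
Qed.

Lemma span_clear D x : (forall a, D a -> exists2 v, cone (gens H) v & cone (gens G) (a + v)) ->
  span D x -> exists2 v, cone (gens H) v & S (x * lX v).
Proof.
move=> DH; elim=> [|c a y Da _ [v cv Sv]].
  by exists 0; [exact: NN0 | rewrite mul0r; constructor].
have [u cu cau] := DH a Da; exists (u + v); first exact: NND.
rewrite mulrDl; apply: spanD.
  rewrite -mulrA -lXD -[_ * _]addr0; constructor; last by constructor.
  by rewrite addrA; apply: NND => //; exact: coneH_G.
by rewrite lXD mulrCA; apply: span_shift Sv => d; apply: NND; exact: coneH_G.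
Qed.

(** The number m is the lowest t-degree in x, found just below the least lower bound that fails; a
    bound above all degrees of x does fail. *)
Lemma initial_degree x : span (fun a => 0 <= ev t a) x -> x != 0 ->
  exists m : nat, span (fun a => m%:Z <= ev t a) x /\ ~ span (fun a => m%:Z < ev t a) x.
Proof.
move=> x0 xn0.
have [N hN] : exists N : nat, span (fun a => ev t a < N%:Z) x.
  have : span (fun=> True) x by apply: span_mono x0.
  elim=> [|c a y _ _ [N hN]]; first by exists 0%N; constructor.
  exists (N + (absz (ev t a)).+1)%N; constructor; first by lia.
  by apply: span_mono hN => b; lia.
have ex : exists m : nat, `[< ~ span (fun a => m%:Z <= ev t a) x >].
  exists N; apply/asboolP => hN'; case/eqP: xn0.
  by apply: (span_disjoint hN hN') => a; lia.
case: (ex_minnP ex) => -[|m] /asboolP nm minm; first by case: nm.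
exists m; split; last by move=> h; apply: nm; apply: span_mono h => a; lia.
apply: contrapT => h; have /minm : `[< ~ span (fun a => m%:Z <= ev t a) x >] by apply/asboolP.
by rewrite ltnn.
Qed.

(** Suppose Q contains no monomial of an edge outside H, hence no monomial at all. With m the lowest
    degree of x, the norm of x / x^(m rho(e1)) lies over ZZ H + ZZ rho(e1), in nonnegative degree
    with nonzero degree 0 part. Up to monomials outside Q it is a multiple of x, so it would lie in
    Q and thus in P, which has only positive degrees. *)
Lemma facet_height Q x : is_prime S Q -> (forall y, Q y -> P y) -> Q x -> x != 0 ->
  forall y, P y -> Q y.
Proof.
move=> hQ QP Qx x0.
have [[e eG Qe]|noe] := EM (exists2 e, e \in G :\: H & Q (lX (rhov e))).
  by apply: (face_ideal_sub hQ); exact: facet_prime_edge hQ QP eG Qe.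
have units v : v \in gens G -> ~ Q (lX v).
  case/gensP => e eG -> Qe; have [eH|neH] := boolP (e \in H).
    by apply: (coneH_notin _ (QP _ Qe)); apply: NN_gen; exact: mem_gens.
  by apply: noe; exists e => //; rewrite inE neH.
have Qmon a : cone (gens G) a -> ~ Q (lX a) by exact: torus_monomial hQ units a.
have Smon a : cone (gens G) a -> S (lX a) by exact: spanX.
have e1_G : e1 \in G by move: e1G; rewrite inE => /andP [].
have latHG a : lat (gens H) a -> lat (gens G) a by apply: lat_sub; exact: gens_sub.
have Sx := primeW hQ Qx.
have [m [xm nxm]] : exists m : nat,
    span (fun a => m%:Z <= ev t a) x /\ ~ span (fun a => m%:Z < ev t a) x.
  by apply: initial_degree => //; apply: span_mono Sx; exact: cone_ge0 facet_ge0.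
(* Each edge vector is corrected to degree 0 by e1; as t(e1) = 1, twice the result lies in ZZ H by
   [prop2]. *)
pose ws := [seq rhov e - rhov e1 *~ ev t (rhov e) | e <- enum G].
have hws w : w \in ws -> half_period w.
  case/mapP => e; rewrite mem_enum => eG ->.
  have tw : ev t (rhov e - rhov e1 *~ ev t (rhov e)) = 0 by rewrite evB evMz t1 intz subrr.
  split=> //; rewrite /base_lat evMn tw mul0rn mulr0z subr0.
  by have := prop2 eG e1_G; rewrite t1 mulr1z.
have [gD gN] := ext_lat_group hws.
have base_e1 (j : int) : base_lat (rhov e1 *~ j).
  by rewrite /base_lat evMz t1 intz subrr; exact: ZZ0.
have lat_ext a : lat (gens G) a -> ext_lat ws a.
  have gen v : v \in gens G -> ext_lat ws v.
    case/gensP => e eG ->; apply: (@ext_lat_mem _ (rhov e - rhov e1 *~ ev t (rhov e))).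
      by apply/mapP; exists e => //; rewrite mem_enum.
    by rewrite subKr; exact: base_e1.
  elim=> [|v b /gen gv _ gb|v b /gen gv _ gb].
  - by apply: base_ext; rewrite -[0](mulr0z (rhov e1)); exact: base_e1.
  - exact: gD.
  - by apply: gD => //; exact: gN.
have lat_e1 j : lat (gens G) (rhov e1 *~ j).
  by apply: ZZMz; apply: lat_mem; exact: mem_gens.
have base_G a : base_lat a -> lat (gens G) a.
  by move=> /latHG h; rewrite -[a](subrK (rhov e1 *~ ev t a)); exact: (ZZD h (lat_e1 _)).
have ext_G us a : {subset us <= ws} -> ext_lat us a -> lat (gens G) a.
  elim: us a => [|w us IH] a sub /=; first exact: base_G.
  have {}IH b : ext_lat us b -> lat (gens G) b.
    by apply: IH => w' w'us; apply: sub; rewrite inE w'us orbT.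
  case=> /IH // h; rewrite -[a](subrK w); apply: ZZD => //.
  have /mapP [e] := sub w (mem_head _ _); rewrite mem_enum => eG ->.
  exact: (ZZB (lat_mem (mem_gens eG)) (lat_e1 _)).
pose f := lX (rhov e1 *~ (- m%:Z)) * x.
have te1 : ev t (rhov e1 *~ (- m%:Z)) = - m%:Z by rewrite evMz t1 intz.
have [||g [sg hfg nfg]] := @norm_exists ws f hws.
- apply: (span_shift (D := fun a => lat (gens G) a /\ m%:Z <= ev t a)).
    move=> b [lb tb]; split; last by rewrite evD te1; lia.
    by apply: lat_ext; exact: (ZZD (lat_e1 _) lb).
  by apply: span_and => //; apply: span_mono Sx => a; exact: NN_ZZ.
- move=> h; apply: nxm; have -> : x = lX (rhov e1 *~ m%:Z) * f.
    by rewrite /f mulrA -lXD -mulrzDr subrr mulr0z lX0 mul1r.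
  by apply: span_shift h => b; rewrite evD evMz t1 intz; lia.
have [|u cu Su] := span_clear _ hfg.
  (* In degree j >= 0 the part along e1 is a monomial of S, so only a denominator supported on H,
     which avoids P, has to be cleared. *)
  move=> a [/ZZ_diff [u [u' [cu cu' E]]] ta]; exists u' => //.
  have [j Ej] : exists j : nat, ev t a = j%:Z by exists (absz (ev t a)); lia.
  have -> : a + u' = u + rhov e1 *+ j.
    by move: E; rewrite Ej -pmulrn => /eqP; rewrite subr_eq addrAC => /eqP ->; rewrite subrK.
  apply: NND; first exact: coneH_G.
  by apply: NNMn; apply: NN_gen; exact: mem_gens.
have [v cv Sv] : exists2 v, cone (gens G) v & S (g * lX v).
  apply: (torus_clear (s := gens G)) => //.
  by apply: span_mono sg => a; apply: ext_G.
have cm : cone (gens G) (rhov e1 *+ m) by apply: NNMn; apply: NN_gen; exact: mem_gens.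
have Qfg : Q (f * g * lX u).
  have : Q (f * g * lX u * (lX v * lX (rhov e1 *+ m))).
    have -> : f * g * lX u * (lX v * lX (rhov e1 *+ m)) = x * (g * lX v * lX u).
      rewrite /f mulrNz lXN -pmulrn; have := lX_neq0 k (rhov e1 *+ m).
      by move: (lX (rhov e1 *+ m)) => y y0; exact: cancel_shift.
    apply: (primeMr hQ) => //; apply: (subringM hS) => //; apply: Smon; exact: coneH_G.
  case/(prime_mul hQ Su); [by apply: (subringM hS); exact: Smon | by [] |].
  by rewrite -lXD => /Qmon []; exact: NND.
have := face_ideal_pos (QP _ Qfg) => h; case: nfg.
have -> : f * g = lX (- u) * (f * g * lX u) by rewrite lXN mulrCA mulrC -mulrA mulVf ?mulr1 ?lX_neq0.
by apply: span_shift h => b; rewrite evD evN (coneH_ev cu) oppr0 add0r.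
Qed.

End Height.
End FacetIdeal.
End FacePrime.

(** * The two implications *)

Section Serre.
Variables (k : fieldType) (n : nat).
Notation F := (LFrac k n).
Notation lX := (@lX k n).
Notation span := (@span k n).

Section NotRegular.
Variables (G H : {set edge n}) (t : 'I_n -> int).
Hypothesis tH : kills t H.
Hypothesis tpos : forall e, e \in G :\: H -> 0 < ev t (rhov e).
Hypothesis HG : H \subset G.
Let S := span (cone (gens G)).
Let P := @face_ideal k n (gens G) t.
Let hS : is_subring S := span_NN_subring k (fun v => v \in gens G).
Let hP : is_prime S P. Proof. exact: (face_prime k (facet_ge0 tH tpos)). Qed.

Lemma facet_not_regular e1 e2 : e1 \in G :\: H -> e2 \in G :\: H ->
  ev t (rhov e1) = 1 -> ev t (rhov e2) = 1 ->
  ~ lat (gens H) (rhov e1 - rhov e2) -> krull_dim_le (localization S P) 1 ->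
  ~ regular_local (localization S P).
Proof.
move=> e1G e2G t1 t2 nl dim1 reg.
have Pe1 : P (lX (rhov e1)) by exact: (face_ideal_edge k tpos).
have Pe2 : P (lX (rhov e2)) by exact: (face_ideal_edge k tpos).
have [a Ma gen] := regular_principal hS hP dim1 reg Pe1 (lX_neq0 _ _).
have [r1 Ar1 E1] := gen _ (loc_ideal_incl hS hP Pe1).
have [r2 Ar2 E2] := gen _ (loc_ideal_incl hS hP Pe2).
have a0 : a != 0 by apply/eqP => a0; have := lX_neq0 k (rhov e1); rewrite E1 a0 mulr0 eqxx.
have r20 : r2 != 0 by apply/eqP => r0; have := lX_neq0 k (rhov e2); rewrite E2 r0 mul0r eqxx.
have hA := loc_subring hS hP.
(* If r2 were not a unit, clearing denominators would make s s' equal to x^(-rho(e2)) times two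
   elements of P, hence of degree at least 1; but s s' is not in P. *)
have [Mr2|nMr2] := EM (loc_ideal S P P r2).
  move: Mr2 Ma => [p [s [Pp [Ss [Ps Er2]]]]] [p' [s' [Pp' [Ss' [Ps' Ea]]]]].
  apply: (prime_notinM hP Ss Ss' Ps Ps').
  have s0 := prime_neq0 hP Ps; have s'0 := prime_neq0 hP Ps'.
  have pos : span (fun b => 0 < ev t b) (s * s').
    have -> : s * s' = lX (- rhov e2) * (p * p').
      apply: (mulfI (lX_neq0 k (rhov e2))).
      rewrite [RHS]mulrA -[lX (rhov e2) * lX _]lXD subrr lX0 mul1r E2 Er2 Ea.
      by rewrite mulrACA [p / s * s]divfK // [p' / s' * s']divfK.
    apply: (span_shift (D := fun b => 1 < ev t b)).
      by move=> b tb; rewrite evD evN t2; lia.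
    apply: spanM (face_ideal_pos Pp) (face_ideal_pos Pp') => b c; rewrite evD; lia.
  exact: (span_and (subringM hS Ss Ss') pos).
have [b [s [Sb [Ss [Ps Ew]]]]] : localization S P (lX (rhov e1 - rhov e2)).
  have -> : lX (rhov e1 - rhov e2) = r1 * r2^-1.
    by rewrite lXB E1 E2 -mulf_div divff // mulr1.
  by apply: (subringM hA) => //; exact: locM_unit.
have s0 := prime_neq0 hP Ps; set w := rhov e1 - rhov e2 in Ew nl.
have tw : ev t w = 0 by rewrite evB t1 t2 subrr.
have {Ew} Eb : lX w * s = b by rewrite Ew divfK.
have [s1 [s2 [s1P s2P Es]]] := span_split (fun c => 0 < ev t c) Ss.
have [b1 [b2 [b1P b2P Eb']]] := span_split (fun c => 0 < ev t c) Sb.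
have lat0 x : span (fun c => cone (gens G) c /\ ~ 0 < ev t c) x -> span (lat (gens H)) x.
  apply: span_mono => c [cc /negP]; rewrite -leNgt => tc.
  exact: (NN_ZZ (cone_face tH tpos HG cc tc)).
(* Multiplication by x^w preserves degrees, so the degree 0 parts match. Both s2 and b2 have
   exponents in ZZ H while w is not in ZZ H, so s2 = 0 and s lies in P, a contradiction. *)
have [E0 _] : lX w * s2 = b2 /\ lX w * s1 = b1.
  apply: (@span_split_eq k n (fun c => ~ 0 < ev t c) (fun c => 0 < ev t c)).
  - by apply: span_shift s2P => c [_]; rewrite evD tw add0r.
  - by apply: span_mono b2P => c [].
  - by apply: span_shift s1P => c [_]; rewrite evD tw add0r.
  - by apply: span_mono b1P => c [].
  - by move=> c.
  - by rewrite -mulrDr addrC -Es Eb Eb' addrC.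
apply: Ps; suff -> : s = s1 by exact: s1P.
rewrite Es; suff -> : s2 = 0 by rewrite addr0.
apply: (mulfI (lX_neq0 k w)); rewrite mulr0.
apply: (span_disjoint (D := fun c => lat (gens H) (c - w)) (E := lat (gens H))).
- by apply: span_shift (lat0 _ s2P) => c; rewrite addrC addKr.
- by rewrite E0; exact: lat0.
- by move=> c cw cc; apply: nl; have := ZZB cc cw; rewrite subKr.
Qed.

End NotRegular.

Lemma serre_R1_comp_bound (G H : {set edge n}) : serre_R1 (@edge_ring k n G) ->
  facet_subgraph G H -> (ncomp H <= (ncomp G).+1)%N.
Proof.
rewrite edge_ring_span => R1 facet; rewrite leqNgt; apply/negP => big.
have HG : H \subset G by case/andP: facet => /andP [].
have [C [L [CH bL pos prop]]] := facet_functional facet.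
have [e1 [e2 [e1G e2G t1 t2 nl]]] := comp_big_witness CH pos big.
have kH := sgn_kills CH bL.
have hP := face_prime k (facet_ge0 kH pos).
have hS := span_NN_subring k (fun v => v \in gens G).
have dim1 : krull_dim_le (localization (span (cone (gens G))) (@face_ideal k n (gens G) (sgn C L))) 1.
  apply: minimal_krull_le1 => // Q x hQ QP Qx x0.
  by apply: (facet_height kH pos HG e1G t1 _ hQ QP Qx x0); exact: prop_lat prop.
by apply: (facet_not_regular kH pos HG e1G e2G t1 t2 nl dim1); exact: R1.
Qed.

Lemma comp_bound_serre_R1 (G : {set edge n}) :
  (forall H : {set edge n}, H \subset G -> facet_subgraph G H -> (ncomp H <= (ncomp G).+1)%N) ->
  serre_R1 (@edge_ring k n G).
Proof.
rewrite edge_ring_span => bound P hP dim1.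
have hS := span_NN_subring k (fun v => v \in gens G).
pose H0 := [set e in G | `[< ~ P (lX (rhov e)) >]].
have HG0 : H0 \subset G by apply/subsetP => e; rewrite inE => /andP [].
have H0P e : e \in H0 -> ~ P (lX (rhov e)) by rewrite inE => /andP [_ /asboolP].
have GH0P e : e \in G :\: H0 -> P (lX (rhov e)).
  by rewrite !inE negb_and => /andP [/orP [/negbTE ->//|/asboolPn nn] _]; exact: contrapT.
have [[e1 e1G]|none] := EM (exists e, e \in G :\: H0); last first.
  apply: torus_regular => // _ /gensP [e eG ->]; apply: H0P; apply: contrapT => /negP ne.
  by apply: none; exists e; rewrite inE ne.
have Smon a : cone (gens G) a -> span (cone (gens G)) (lX a) by exact: spanX.
have coneH0 a : cone (gens H0) a -> cone (gens G) a by apply: cone_sub; exact: gens_sub.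
have nP a : cone (gens H0) a -> ~ P (lX a).
  elim=> [|v b /gensP [e eH ->] cb IH]; first by rewrite lX0; exact: primeN1 hP.
  rewrite lXD; apply: (prime_notinM hP) => //; last exact: H0P.
    by apply/Smon/coneH0/NN_gen/mem_gens.
  exact/Smon/coneH0.
have [|H facet H0H] := exists_facet HG0 (ex_intro _ e1 e1G).
  move=> _ [_ [u [/gensP [e eG ->] cu ->]]] /ZZ_diff [p [q [cp cq E]]].
  (* A relation excluded by [gordan] would write x^p, a monomial supported on H0 and so outside P,
     as a multiple of an edge monomial that lies in P. *)
  apply: (nP p cp); have -> : p = rhov e + (u + q) by rewrite addrA E subrK.
  rewrite lXD; apply: (primeMr hP); first exact: GH0P.
  apply: Smon; apply: NND; last exact: coneH0.
  by apply: cone_sub cu; apply: gens_sub; exact: subsetDl.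
have HG : H \subset G by case/andP: facet => /andP [].
have [C [L [CH bL pos prop]]] := facet_functional facet.
have kH := sgn_kills CH bL.
have hPs := face_prime k (facet_ge0 kH pos).
have [e0 e0G gen] := comp_small_generator HG CH bL pos prop facet (bound H HG facet).
pose Q := @face_ideal k n (gens G) (sgn C L).
have QP x : Q x -> P x.
  apply: (face_ideal_sub kH hP) => e; rewrite inE => /andP [neH eG].
  by apply: GH0P; rewrite inE eG andbT; apply: contra neH; exact: (subsetP H0H).
have PQ x : P x -> Q x.
  apply: (krull_le1_minimal hS hP dim1 hPs QP (x := lX (rhov e0))).
    exact: (face_ideal_edge k pos).
  exact: lX_neq0.
have PE : P = Q by apply: funext => x; apply: propext; split; [exact: PQ | exact: QP].
by rewrite PE in dim1 *; exact: (facet_regular kH pos HG dim1 e0G gen).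
Qed.

End Serre.

Theorem mainTheorem11 (k : fieldType) (n : nat) (G : {set edge n}) :
  wf_graph G ->
  (serre_R1 (@edge_ring k n G) <->
   forall H : {set edge n}, H \subset G -> facet_subgraph G H ->
     (ncomp H <= (ncomp G).+1)%N).
Proof.
move=> _; split=> [R1 H _|]; first exact: (serre_R1_comp_bound R1).
exact: comp_bound_serre_R1.
Qed.
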